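(* Let $k$ be an algebraically closed field and $n\ge4$. Let $q^{(1)},q^{(2)},q^{(3)}$ be the first three spinor coordinates (denoted $q_{\mathrm{id}}$, $q_{s_{n-1}}$, $q_{s_{n-2}s_{n-1}}$, see context) on the orthogonal Grassmannian $\operatorname{OGr}(n,2n)$. The ideal $(q^{(1)},q^{(2)},q^{(3)})$ in the homogeneous coordinate ring $k[\operatorname{OGr}(n,2n)]$ is generated by a regular sequence. Therefore, these coordinates restricted to the open cell $Y$ also generate an ideal generated by a regular sequence in $k[Y]$. Moreover, these elements generate a radical ideal.
   Context: $\operatorname{OGr}(n,2n)$ denotes one connected component of the Grassmannian of $n$-dimensional isotropic subspaces of a $2n$-dimensional $k$-vector space with a non-degenerate quadratic form admitting a hyperbolic basis $\{e_1,\dots,e_n,\bar e_n,\dots,\bar e_1\}$. It is embedded in the projective space of a $2^{n-1}$-dimensional half-spinor representation, and $k[\operatorname{OGr}(n,2n)]$ is the homogeneous coordinate ring of this embedding, generated by the $2^{n-1}$ spinor coordinates. The big open cell $Y\subset\operatorname{OGr}(n,2n)$ is the affine space of dimension $\binom n2$ whose points are the subspaces with a (unique) basis given by the rows of a matrix $(J\mid X)$ in the hyperbolic basis, with $J$ the antidiagonal permutation matrix and $X=(x_{ij})$ a skew symmetric $n\times n$ matrix; so $k[Y]=k[x_{ij}\mid 1\le i<j\le n]$. Spinor coordinates $q_I$ are indexed by the subsets $I\subseteq\{1,\dots,n\}$ with $|I|\equiv n\pmod 2$; the restriction of $q_I$ to $Y$ is the Pfaffian of the submatrix of $X$ obtained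 by removing the rows and columns with indices $n+1-i$ for $i\in I$ (the Pfaffian of the empty matrix is $1$). Equivalently, $k[\operatorname{OGr}(n,2n)]$ is the graded $k$-subalgebra of $k[x_{ij}][t]$ generated by the elements $t\cdot\operatorname{Pf}(X_S)$, where $X_S$ runs through the principal submatrices of $X$ of even size. In the natural partial order (induced by the Weyl group of type $D_n$) the first three coordinates are: for $n$ even $q_{\emptyset},q_{\{n-1,n\}},q_{\{n-2,n\}}$, which restrict on $Y$ to $\operatorname{Pf}(X),\operatorname{Pf}_{\overline{12}}(X),\operatorname{Pf}_{\overline{13}}(X)$; for $n$ odd $q_{\{n\}},q_{\{n-1\}},q_{\{n-2\}}$, which restrict on $Y$ to $\operatorname{Pf}_{\overline1}(X),\operatorname{Pf}_{\overline2}(X),\operatorname{Pf}_{\overline3}(X)$. Here $\operatorname{Pf}_{\overline{i_1\ldots i_k}}(X)$ is the Pfaffian after removing rows and columns $i_1,\dots,i_k$. *)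

(* Defs.v *)
From HB Require Import structures.
From mathcomp Require Import all_boot all_order all_algebra.
From mathcomp Require Import boolp.
From mathcomp Require Import mpoly.

Set Implicit Arguments.
Unset Strict Implicit.
Unset Printing Implicit Defensive.

Import GRing.Theory.
Local Open Scope ring_scope.

Definition ideal_gen (R : comNzRingType) (s : seq R) (x : R) : Prop :=
  exists c : 'I_(size s) -> R, x = \sum_(i < size s) c i * s`_i.

(* s`_i is a nonzerodivisor modulo (s`_0, ..., s`_(i-1)) for every i, and the
   quotient by the whole ideal is nonzero. *)
Definition regular_seq (R : comNzRingType) (s : seq R) : Prop :=
  (forall (i : 'I_(size s)) (x : R),
     ideal_gen (take i s) (s`_i * x) -> ideal_gen (take i s) x) /\
  ~ ideal_gen s 1.

Definition radical_ideal (R : comNzRingType) (J : R -> Prop) : Prop :=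
  forall (x : R) (m : nat), J (x ^+ m) -> J x.

(* Expansion along the first row; it involves no division, hence makes sense
   in every characteristic.  Only the entries above the diagonal are used. *)
Fixpoint Pf (R : comNzRingType) (m : nat) : 'M[R]_m -> R :=
  match m return 'M[R]_m -> R with
  | 0 => fun _ => 1
  | 1 => fun _ => 0
  | m'.+2 => fun A =>
      \sum_(j < m'.+1) (-1) ^+ j * A ord0 (lift ord0 j) *
        Pf (row' j (col' j (row' ord0 (col' ord0 A))))
  end.

Lemma Pf_odd (R : comNzRingType) (m : nat) (A : 'M[R]_m) : odd m -> Pf A = 0.
Proof.
have [N] := ubnP m; elim: N m A => // N IHN [|[|m]] A //= ltmN.
rewrite negbK => oddm; apply: big1 => j _; rewrite IHN ?mulr0 //.
by rewrite -ltnS; apply: leq_trans ltmN; apply: leqW.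
Qed.

(* enum_val enumerates S : {set 'I_n} in increasing order. *)
Definition principal_submx (R : Type) (n : nat) (A : 'M[R]_n) (S : {set 'I_n}) :
    'M[R]_#|S| :=
  mxsub (@enum_val _ (mem S)) (@enum_val _ (mem S)) A.

Definition cell_index (n : nat) : predArgType :=
  {p : 'I_n * 'I_n | (p.1 < p.2)%N}.

Notation cell_ring k n := {mpoly k[#|{: cell_index n}|]}.

Definition cell_var (k : closedFieldType) (n : nat) (p : cell_index n) :
    cell_ring k n :=
  'X_(enum_rank p).

Definition cell_mx (k : closedFieldType) (n : nat) : 'M[cell_ring k n]_n :=
  \matrix_(i, j)
    if insub (i, j) is Some p then cell_var k p
    else if insub (j, i) is Some p then - cell_var k p
    else 0.

(* Subsets of {1, ..., n} are encoded in {set 'I_n} by shifting by one, so that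
   i |-> n + 1 - i becomes rev_ord. *)
Definition spinor_cell (k : closedFieldType) (n : nat) (I : {set 'I_n}) :
    cell_ring k n :=
  Pf (principal_submx (cell_mx k n) (~: [set rev_ord i | i in I])).

(* k[OGr(n,2n)], as the k-subalgebra of k[Y][t] generated by the t * q_I|_Y;
   here 'X is t. *)
Inductive in_OGr (k : closedFieldType) (n : nat) : {poly cell_ring k n} -> Prop :=
  | OGr_const (c : k) : in_OGr (c%:MP)%:P
  | OGr_spinor (I : {set 'I_n}) :
      odd #|I| = odd n -> in_OGr ('X * (spinor_cell k I)%:P)
  | OGr_add f g : in_OGr f -> in_OGr g -> in_OGr (f + g)
  | OGr_mul f g : in_OGr f -> in_OGr g -> in_OGr (f * g).

Definition OGr_pred (k : closedFieldType) (n : nat) :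
    {pred {poly cell_ring k n}} :=
  fun f => `[< in_OGr f >].

Lemma OGr_subring (k : closedFieldType) (n : nat) :
  subring_closed (@OGr_pred k n).
Proof.
split=> [|f g /asboolP Hf /asboolP Hg|f g /asboolP Hf /asboolP Hg].
- by apply/asboolP; have := OGr_const n (1 : k); rewrite mpolyC1.
- apply/asboolP; apply: OGr_add => //.
  have := OGr_mul (OGr_const n (-1 : k)) Hg.
  by rewrite mpolyCN mpolyC1 polyCN mulN1r.
- by apply/asboolP; apply: OGr_mul.
Qed.

HB.instance Definition _ (k : closedFieldType) (n : nat) :=
  GRing.isSubringClosed.Build _ (@OGr_pred k n) (@OGr_subring k n).

Record OGr_ring (k : closedFieldType) (n : nat) := MkOGr {
  OGr_val :> {poly cell_ring k n};
  _ : OGr_val \in @OGr_pred k n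
}.

HB.instance Definition _ (k : closedFieldType) (n : nat) :=
  [isSub for @OGr_val k n].
HB.instance Definition _ (k : closedFieldType) (n : nat) :=
  [Choice of OGr_ring k n by <:].
HB.instance Definition _ (k : closedFieldType) (n : nat) :=
  [SubChoice_isSubComNzRing of OGr_ring k n by <:].

(* When #|I| and n have different parities the Pfaffian below is 0. *)
Lemma spinor_in_OGr (k : closedFieldType) (n : nat) (I : {set 'I_n}) :
  'X * (spinor_cell k I)%:P \in @OGr_pred k n.
Proof.
apply/asboolP; case: (boolP (odd #|I| == odd n)) => [/eqP|] hI.
  exact: OGr_spinor.
rewrite /spinor_cell Pf_odd ?mulr0.
  by have := OGr_const n (0 : k); rewrite mpolyC0.
have E : odd n = odd #|I| (+) odd #|~: [set rev_ord i | i in I]|.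
  by rewrite -(card_imset (mem I) (@rev_ord_inj n)) -oddD cardsC card_ord.
by move: hI; rewrite E; case: (odd #|I|); case: (odd _).
Qed.

Definition spinor (k : closedFieldType) (n : nat) (I : {set 'I_n}) :
    OGr_ring k n :=
  MkOGr (spinor_in_OGr k I).

(* Restriction to Y is dehomogenization at q_{1, ..., n} = t. *)
Definition restrict_cell (k : closedFieldType) (n : nat) (f : OGr_ring k n) :
    cell_ring k n :=
  (f : {poly cell_ring k n}).[1].

Lemma restrict_spinor (k : closedFieldType) (n : nat) (I : {set 'I_n}) :
  restrict_cell (spinor k I) = spinor_cell k I.
Proof. by rewrite /restrict_cell /= hornerM hornerX hornerC mul1r. Qed.

(* The elements of s are one-based. *)
Definition subset_of_seq (n : nat) (s : seq nat) : {set 'I_n} :=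
  [set i : 'I_n | i.+1 \in s].

Definition first_spinor_sets (n : nat) : seq {set 'I_n} :=
  map (@subset_of_seq n)
    (if odd n then [:: [:: n]; [:: (n - 1)%N]; [:: (n - 2)%N]]
     else [:: [::]; [:: (n - 1)%N; n]; [:: (n - 2)%N; n]]).

(* [:: q_id; q_(s_(n-1)); q_(s_(n-2) s_(n-1))] *)
Definition first_spinors (k : closedFieldType) (n : nat) : seq (OGr_ring k n) :=
  map (@spinor k n) (first_spinor_sets n).

(* Main.v *)
From HB Require Import structures.
Require Import Defs.
From mathcomp Require Import all_boot all_order all_algebra.
From mathcomp Require Import fingroup perm.
From mathcomp Require Import mpoly.
From mathcomp Require Import boolp.
From mathcomp Require Import zify ring.

(** Why the result holds.  Everything is deduced from a degeneration of the
coordinate ring that exists in every characteristic.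

Let F_d be the span in k[Y] of the products of at most d principal Pfaffians,
so that k[OGr] is the direct sum of the F_d t^d.  After renumbering the indices
by a permutation rho, give the variable in position (i, j), i < j, the weight
K - i j, and write top f for the part of f of largest weight.  Call cell a
position (i, j) with i < j; cells are ordered by (i, j) <= (i', j') when i <= i'
and j <= j', and the width of a monomial is its largest degree along a chain.

- Nested pairs of edges outweigh crossing ones, which outweigh disjoint ones.
  Hence the top part of a Pfaffian is, up to sign, the product of the cells of
  the nested perfect matching, which is an antichain of cells ([pf_lead]).

- Every monomial of width at most d is the top part of an element of F_d
  ([filt_lift]): its minimal cells form an antichain meeting all the chains of
  largest degree, so that dividing by the top part of one Pfaffian lowers the
  width.

- Conversely every monomial in the top part of an element f of F_d has width at
  most d ([filt_width]).  Pfaffians are affine in s along the rank two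
  deformation X + s (u v^T - v u^T), so f has degree at most d in s on it.  A
  chain is the minimum of the weight among the monomials with given row and
  column content; linear programming duality turns this into weights for the
  u_i and v_j.  With X set to 0 where the dual bound is tight, the deformation
  then replaces in top parts the cells of the chain by s u_i v_j, and the degree
  in s becomes the degree along the chain.

- For a suitable rho, the three coordinates restrict to Pfaffians whose top
  parts are products of all the cells of three different lines i + j = c.  These
  monomials are squarefree and pairwise coprime, so that they form a regular
  sequence generating a radical ideal.  Moreover every chain extends to one that
  meets a given line ([line_hit]), so dividing by such a product also lowers the
  width.

Therefore the division algorithm by p_0, p_1, p_2 reads off everything from top
parts, and stays inside the filtration: these elements form a regular sequence
in k[Y], the ideal I that they generate is radical, and the intersection of I
with F_d is the sum of the p_i F_(d-1) ([comb_filtered]).  The last equality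
says that an element of k[OGr] lies in the ideal of the three coordinates as
soon as its coefficients in t lie in I, which carries both properties over to
k[OGr]. *)

Set Implicit Arguments.
Unset Strict Implicit.
Unset Printing Implicit Defensive.

Import GRing.Theory.
Local Open Scope ring_scope.

(** * Pfaffians of lists of indices *)

Section Contraction.
Variables (R : comNzRingType) (I : Type).
Implicit Types (w u v : I -> R) (g h : seq I -> R) (s t : seq I).

(** Contraction by a linear form in the exterior algebra, acting on functions of
index lists: g is removed one entry at a time, with alternating signs. *)
Fixpoint contr w g s : R :=
  if s is j :: s' then w j * g s' - contr w (fun t => g (j :: t)) s' else 0.

Lemma contr_ext w w' g g' s : w =1 w' ->
  (forall t, (size t).+1 = size s -> g t = g' t) ->
  contr w g s = contr w' g' s.
Proof.
move=> ew; elim: s g g' => //= j s IHs g g' eg.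
rewrite ew eg //; congr (_ - _); apply: IHs => t et.
by apply: eg => /=; rewrite et.
Qed.

Lemma contrDl w w' g s : contr (fun i => w i + w' i) g s = contr w g s + contr w' g s.
Proof. by elim: s g => [|j s IHs] g /=; [rewrite addr0 | rewrite IHs; ring]. Qed.

Lemma contrZl c w g s : contr (fun i => c * w i) g s = c * contr w g s.
Proof. by elim: s g => [|j s IHs] g /=; [rewrite mulr0 | rewrite IHs; ring]. Qed.

Lemma contrDr w g g' s : contr w (fun t => g t + g' t) s = contr w g s + contr w g' s.
Proof.
elim: s g g' => [|j s IHs] g g' /=; first by rewrite addr0.
by rewrite (IHs (fun t => g (j :: t)) (fun t => g' (j :: t))); ring.
Qed.

Lemma contrZr c w g s : contr w (fun t => c * g t) s = c * contr w g s.
Proof.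
elim: s g => [|j s IHs] g /=; first by rewrite mulr0.
by rewrite (IHs (fun t => g (j :: t))); ring.
Qed.

Lemma contr0r w s : contr w (fun=> 0) s = 0.
Proof. by elim: s => //= j s IHs; rewrite IHs; ring. Qed.

Lemma contr_cons2 w v g j s : contr w (contr v g) (j :: s) =
  w j * contr v g s - v j * contr w g s + contr w (contr v (fun t => g (j :: t))) s.
Proof.
have -> : contr w (contr v g) (j :: s) = w j * contr v g s -
    contr w (fun t => v j * g t + -1 * contr v (fun t => g (j :: t)) t) s.
  by rewrite /=; congr (_ - _); apply: contr_ext => // t _; ring.
by rewrite contrDr contrZr (contrZr (-1)); ring.
Qed.

(** Contractions anticommute; together with [contr_sq] this replaces all the
manipulations of double sums with signs. *)
Lemma contrC w v g s : contr w (contr v g) s = - contr v (contr w g) s.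
Proof.
elim: s g => [|j s IHs] g; first by rewrite /= oppr0.
by rewrite !contr_cons2 IHs; ring.
Qed.

Lemma contr_sq w g s : contr w (contr w g) s = 0.
Proof. by elim: s g => // j s IHs g; rewrite contr_cons2 IHs; ring. Qed.

Lemma contr_sum (x0 : I) w g s : contr w g s =
  \sum_(j < size s) (-1) ^+ j * w (nth x0 s j) * g (take j s ++ drop j.+1 s).
Proof.
elim: s g => [|i s IHs] g /=; first by rewrite big_ord0.
rewrite big_ord_recl /= expr0 mul1r drop0 IHs -sumrN; congr (_ + _).
by apply: eq_bigr => j _; rewrite /bump /= add1n exprS; ring.
Qed.

Lemma contr_closed (P : R -> Prop) w g s :
  (forall x y, P x -> P y -> P (x - y)) -> (forall x y, P x -> P y -> P (x * y)) ->
  P 0 -> (forall i, P (w i)) -> (forall t, P (g t)) -> P (contr w g s).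
Proof.
move=> PB PM P0 Pw; elim: s g => //= j s IHs g Pg.
by apply: PB; [apply: PM | apply: IHs].
Qed.

Definition alternating g := forall s i j t,
  g (s ++ i :: j :: t) = - g (s ++ j :: i :: t).

Lemma alternating_cons g i : alternating g -> alternating (fun t => g (i :: t)).
Proof. by move=> ag s j k t; apply: (ag (i :: s)). Qed.

Lemma alternating_contr w g : alternating g -> alternating (contr w g).
Proof.
move=> ag s; elim: s g ag => [|l s IHs] g ag i j t /=; last first.
  by rewrite ag (IHs (fun t => g (l :: t))); [ring | apply: alternating_cons].
rewrite (@contr_ext w w (fun t => g [:: i, j & t]) (fun t => -1 * g [:: j, i & t])) //.
  by rewrite (contrZr (-1)); ring.
by move=> r _; rewrite (ag [::]); ring.
Qed.

End Contraction.

(** Only the sign can depend on the order in which the indices are listed; this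
makes it possible to list them along an order adapted to the weight. *)
Lemma alternating_perm (R : comNzRingType) (I : eqType) (g : seq I -> R) s t :
  alternating g -> perm_eq s t -> exists b : bool, g s = (-1) ^+ b * g t.
Proof.
elim: s t g => [|i s IHs] t g ag.
  by rewrite perm_sym => /perm_nilP->; exists false; rewrite mul1r.
move=> pst; have it : i \in t by rewrite -(perm_mem pst) mem_head.
case/splitPr: it pst => t1 t2; rewrite perm_sym perm_catC /= perm_cons perm_catC.
rewrite perm_sym => /(IHs _ _ (alternating_cons i ag)) [b ->].
have [c ->] : exists c : bool, g (t1 ++ i :: t2) = (-1) ^+ c * g (i :: t1 ++ t2).
  elim/last_ind: t1 t2 => [|t1 j IH] t2; first by exists false; rewrite mul1r.
  rewrite cat_rcons ag; have [c] := IH (j :: t2); rewrite cat_rcons => ->.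
  by exists (~~ c); case: c; rewrite /=; ring.
exists (b (+) c); rewrite mulrA; congr (_ * _).
by case: b; case: c; rewrite /=; ring.
Qed.

Section ListPfaffian.
Variables (R : comNzRingType) (I : Type).
Implicit Types (x : I -> I -> R) (s t : seq I).

(** The expansion along the first index removes an entry in the middle of the
list, so the recursion is on a bound for the length. *)
Fixpoint pfn x m s : R :=
  if s is i :: s' then (if m is m'.+1 then contr (x i) (pfn x m') s' else 0) else 1.

Definition pf x s := pfn x (size s) s.

Lemma pfn_stable x m m' s : (size s <= m)%N -> (size s <= m')%N ->
  pfn x m s = pfn x m' s.
Proof.
elim: m m' s => [|m IHm] [|m'] [|i s] //=; rewrite !ltnS => sm sm'.
apply: contr_ext => // t et; apply: IHm; lia.
Qed.

Lemma pf_cons x i s : pf x (i :: s) = contr (x i) (pf x) s.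
Proof. rewrite {1}/pf -[LHS]/(contr (x i) (pfn x (size s)) s).
apply: contr_ext => // t et; apply: pfn_stable => //; lia. Qed.

Lemma pf_ind (P : seq I -> Prop) :
  P [::] -> (forall i s, (forall t, (size t <= size s)%N -> P t) -> P (i :: s)) ->
  forall s, P s.
Proof.
move=> P0 PS s; have [m] := ubnP (size s); elim: m s => // m IHm [|i s] // ltsm.
by apply: PS => t ts; apply: IHm; move: ltsm => /=; lia.
Qed.

Lemma pf_ext x x' s : (forall i j, x i j = x' i j) -> pf x s = pf x' s.
Proof.
move=> ex; elim/pf_ind: s => // i s IHs; rewrite !pf_cons.
by apply: contr_ext => // t et; apply: IHs; lia.
Qed.

Lemma pf_closed (P : R -> Prop) x s :
  (forall a b, P a -> P b -> P (a - b)) -> (forall a b, P a -> P b -> P (a * b)) ->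
  P 1 -> (forall i j, P (x i j)) -> P (pf x s).
Proof.
move=> PB PM P1 Px; have P0 : P 0 by rewrite -(subrr 1); apply: PB.
rewrite /pf; move: (size s) => m.
by elim: m s => [|m IHm] [|i s] //=; apply: contr_closed.
Qed.

(** A rank two change of the matrix changes a Pfaffian by a single contraction
term, because the contractions by u and v square to zero: no power of c above
the first survives.  This is the source of the upper bound on widths. *)
Lemma pf_rank2 x u v c s :
  pf (fun i j => x i j + c * (u i * v j - v i * u j)) s =
  pf x s - c * contr v (contr u (pf x)) s.
Proof.
elim/pf_ind: s => [|i s IHs]; first by rewrite /= mulr0 subr0.
rewrite !pf_cons contr_cons2.
pose h t := pf x t + - c * contr v (contr u (pf x)) t.
rewrite (@contr_ext _ _ _ (fun j => x i j + (c * u i * v j + - (c * v i) * u j)) _ h);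
  first last.
- by move=> t et; rewrite /h IHs; [ring | lia].
- by move=> j; ring.
rewrite contrDl contrDl !contrZl /h.
rewrite (contrDr (x i)) (contrDr v) (contrDr u) !(contrZr (- c)) contr_sq.
rewrite (contrC u) (@contr_ext _ _ v v (contr u (contr u (pf x))) (fun=> 0)) //;
  last by move=> t _; apply: contr_sq.
rewrite contr0r.
have -> : contr v (contr u (fun t => pf x (i :: t))) s
        = contr (x i) (contr v (contr u (pf x))) s.
  rewrite (contrC (x i)).
  rewrite (@contr_ext _ _ v v _ (fun t => - 1 * contr (x i) (contr u (pf x)) t)) //.
    by rewrite contrZr; ring.
  move=> t _; rewrite mulN1r -contrC; apply: contr_ext => // r _; exact: pf_cons.
ring.
Qed.

Lemma alternating_pf x : (forall i j, x i j = - x j i) -> alternating (pf x).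
Proof.
move=> xC s i j t.
suff alt m : alternating (pfn x m) by rewrite /pf alt !size_cat.
elim: m => [|m IHm] {s i j t} [|k s] i j t /=; rewrite ?oppr0 //; last first.
  exact: alternating_contr.
case: m IHm => [|m] IHm /=.
  rewrite !(contr0r _ t) (xC i j); ring.
by rewrite (contrC (x j)) (xC i j); ring.
Qed.

End ListPfaffian.

Lemma rmorph_pf (R S : comNzRingType) (f : {rmorphism R -> S}) (I : Type)
    (x : I -> I -> R) (s : seq I) :
  f (pf x s) = pf (fun i j => f (x i j)) s.
Proof.
elim/pf_ind: s => [|i s IHs]; first by rewrite rmorph1.
rewrite !pf_cons.
have -> w (g : seq I -> R) t : f (contr w g t) = contr (fun i => f (w i)) (fun t => f (g t)) t.
  by elim: t g => [|j t IHt] g /=; rewrite ?rmorph0 // rmorphB rmorphM IHt.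
by apply: contr_ext => // t et; apply: IHs; lia.
Qed.

Lemma Pf_pf (R : comNzRingType) (I : Type) (x : I -> I -> R) (x0 : I) m
    (A : 'M[R]_m) (s : seq I) :
  size s = m ->
  (forall i j : 'I_m, (i < j)%N -> A i j = x (nth x0 s i) (nth x0 s j)) ->
  Pf A = pf x s.
Proof.
have [b] := ubnP m; elim: b m A s => // b IHb [|[|m]] A.
- by case.
- by case=> [|i []].
case=> [|i [|k s]] //= ltb [es] eA.
rewrite pf_cons (contr_sum x0) /= es.
apply: eq_bigr => j _; rewrite eA //=; congr (_ * _).
apply: IHb; first by lia.
  rewrite size_cat size_take size_drop /= es.
  by case: ltngtP (ltn_ord j) => /= *; lia.
move=> a c lt_ac; rewrite !mxE eA /=; last first.
  by rewrite /bump; case: (leqP j a); case: (leqP j c); lia.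
rewrite /= !add0n !nth_cat !size_take /= es ltn_ord !nth_drop.
have nth_rem e : nth x0 (k :: s) (bump j e) =
    if (e < j)%N then nth x0 (take j (k :: s)) e else nth x0 s (j + (e - j)).
  rewrite /bump; case: ltnP => le_je; first by rewrite nth_take.
  by rewrite subnKC.
by rewrite !nth_rem.
Qed.
(** * Leading forms for a weight on the variables *)

(** Multiplying each variable by a power of a new variable turns the part of
largest weight into a leading coefficient, whose multiplicativity is free. *)
HB.lock Definition weight_hom (R : idomainType) (N : nat) (om : 'I_N -> nat)
    (f : {mpoly R[N]}) : {poly {mpoly R[N]}} :=
  mmap (polyC \o @mpolyC N R) (fun i => ('X_i)%:P * 'X^(om i)) f.

Section WeightedTop.
Variables (R : idomainType) (N : nat) (om : 'I_N -> nat).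
Local Notation A := {mpoly R[N]}.
Implicit Types (m : 'X_{1..N}) (f g h : A).

Definition wt m := (\sum_i om i * m i)%N.

Lemma wtD m m' : wt (m + m')%MM = (wt m + wt m')%N.
Proof. by rewrite -big_split; apply: eq_bigr => i _; rewrite mnmDE mulnDr. Qed.

Lemma wtU i : wt U_(i)%MM = om i.
Proof.
rewrite /wt (bigD1 i) //= mnm1E eqxx muln1 big1 ?addn0 // => j ji.
by rewrite mnm1E eq_sym (negPf ji) muln0.
Qed.

Local Notation whom := (weight_hom om).

Lemma whomD f g : whom (f + g) = whom f + whom g.
Proof. by rewrite weight_hom.unlock rmorphD. Qed.

Lemma whomN f : whom (- f) = - whom f.
Proof. by rewrite weight_hom.unlock rmorphN. Qed.

Lemma whomM f g : whom (f * g) = whom f * whom g.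
Proof. by rewrite weight_hom.unlock rmorphM. Qed.

Lemma whom1 : whom (1 : A) = 1.
Proof. by rewrite weight_hom.unlock rmorph1. Qed.

Lemma whom0 : whom (0 : A) = 0.
Proof. by rewrite weight_hom.unlock rmorph0. Qed.

Lemma whomX m : whom ('X_[m] : A) = 'X_[m]%:P * 'X^(wt m).
Proof.
rewrite weight_hom.unlock mmapX /mmap1 (mpolyXE_id R m) rmorph_prod /= /wt.
elim/big_rec3: _ => [|i x y z _ ->]; first by rewrite expr0 mulr1.
by rewrite exprMn rmorphXn /= -exprM exprD; ring.
Qed.

Lemma mcoeff_whom f w m : (whom f)`_w@_m = f@_m *+ (wt m == w).
Proof.
have whomZ c g : whom (c *: g) = c%:MP%:P * whom g by rewrite weight_hom.unlock mmapZ.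
have -> : whom f = \sum_(m' <- msupp f) whom (f@_m' *: 'X_[m']).
  by rewrite {1}[f]mpolyE weight_hom.unlock rmorph_sum.
rewrite coef_sum raddf_sum /=.
rewrite [in RHS](mpolyE f) raddf_sum /=.
rewrite -sumrMnl; apply: eq_bigr => m' _.
rewrite whomZ whomX mulrA -polyCM coefCM coefXn.
rewrite mulr_natr mul_mpolyC mcoeffMn !mcoeffZ mcoeffX -!mulrnAr.
by rewrite !(eq_sym w); case: (eqVneq m' m) => [->|]; rewrite ?mul0rn ?eqxx.
Qed.

Definition wdeg f := size (whom f).
Definition top f : A := lead_coef (whom f).

Lemma wdeg_leP f w : reflect {in msupp f, forall m, (wt m < w)%N} (wdeg f <= w)%N.
Proof.
apply: (iffP (leq_sizeP _ _)) => [H m mf|H w' lew].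
  rewrite ltnNge; apply/negP => /H/(congr1 (mcoeff m)).
  by rewrite mcoeff_whom eqxx mcoeff0 => /eqP; rewrite -[_ == 0]negbK -mcoeff_msupp mf.
apply/mpolyP => m; rewrite mcoeff_whom mcoeff0; case: eqVneq => // ewt.
apply/eqP; rewrite mulr1n mcoeff_eq0; apply/negP => /H; lia.
Qed.

Lemma whom_eq0 f : (whom f == 0) = (f == 0).
Proof.
apply/eqP/eqP => [/(congr1 (fun q : {poly A} => size q)) /=|->]; last exact: whom0.
rewrite size_poly0 => /eqP; rewrite -leqn0 => /wdeg_leP H.
apply/eqP; rewrite -msupp_eq0; case: (msupp f) H => // m s /(_ m (mem_head _ _)).
by rewrite ltn0.
Qed.

Lemma wdeg_gt0 f : (0 < wdeg f)%N = (f != 0).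
Proof. by rewrite size_poly_gt0 whom_eq0. Qed.

Lemma top_eq0 f : (top f == 0) = (f == 0).
Proof. by rewrite lead_coef_eq0 whom_eq0. Qed.

Lemma top1 : top 1 = 1.
Proof. by rewrite /top whom1 lead_coef1. Qed.

Lemma topM f g : top (f * g) = top f * top g.
Proof. by rewrite /top whomM lead_coefM. Qed.

Lemma topX f e : top (f ^+ e) = top f ^+ e.
Proof. by elim: e => [|e IHe]; rewrite ?top1 // !exprS topM IHe. Qed.

Lemma wdegM f g : f != 0 -> g != 0 -> wdeg (f * g) = (wdeg f + wdeg g).-1.
Proof. by move=> f0 g0; rewrite /wdeg whomM size_mul ?whom_eq0. Qed.

Lemma mcoeff_top f m : (top f)@_m = f@_m *+ ((wt m).+1 == wdeg f).
Proof.
rewrite /top lead_coefE -/(wdeg f) mcoeff_whom.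
case: (eqVneq f 0) => [->|]; first by rewrite mcoeff0 !mul0rn.
by rewrite -wdeg_gt0; case: (wdeg f).
Qed.

Lemma msupp_top f m :
  (m \in msupp (top f)) = (m \in msupp f) && ((wt m).+1 == wdeg f).
Proof.
by rewrite !mcoeff_msupp mcoeff_top; case: (_ == wdeg f); rewrite ?andbT ?andbF ?eqxx.
Qed.

Lemma wdegB_lt f g : f != 0 -> (wdeg g <= wdeg f)%N ->
  (forall m, (wt m).+1 = wdeg f -> g@_m = f@_m) -> (wdeg (f - g) < wdeg f)%N.
Proof.
rewrite -wdeg_gt0 => f0 le_gf efg; rewrite -(prednK f0) ltnS.
apply/wdeg_leP => m; rewrite mcoeff_msupp mcoeffB => fgm.
have : ((wt m).+1 != wdeg f) by apply: contraNneq fgm => /efg ->; rewrite subrr.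
have : (wt m < wdeg f)%N.
  have [mf|/memN_msupp_eq0 fm] := boolP (m \in msupp f).
    by move/wdeg_leP: (leqnn (wdeg f)) => /(_ m mf).
  move: fgm; rewrite fm sub0r oppr_eq0 -mcoeff_msupp => mg.
  by move/wdeg_leP: le_gf => /(_ m mg).
lia.
Qed.

Lemma wdegD f g : (wdeg (f + g) <= maxn (wdeg f) (wdeg g))%N.
Proof. by rewrite /wdeg whomD size_polyD. Qed.

Lemma wdegN f : wdeg (- f) = wdeg f.
Proof. by rewrite /wdeg whomN size_polyN. Qed.

Lemma wdegZ c f : (wdeg (c *: f) <= wdeg f)%N.
Proof.
apply/wdeg_leP => m /msuppZ_le mf.
by move/wdeg_leP: (leqnn (wdeg f)) => /(_ m mf).
Qed.

Lemma topN f : top (- f) = - top f.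
Proof. by rewrite /top whomN lead_coefN. Qed.

Lemma top0 : top 0 = 0.
Proof. by rewrite /top whom0 lead_coef0. Qed.

Lemma topDl f g : (wdeg g < wdeg f)%N -> top (f + g) = top f.
Proof. by rewrite /top whomD; apply: lead_coefDl. Qed.

Lemma topD_eq f g : wdeg f = wdeg g -> top f + top g != 0 -> top (f + g) = top f + top g.
Proof.
rewrite /top /wdeg !lead_coefE whomD => e; rewrite e -coefD => nz; congr (_`_(_.-1)).
apply/eqP; rewrite eqn_leq; apply/andP; split.
  by rewrite (leq_trans (size_polyD _ _)) // e maxnn.
case E: (size (whom g)) => [//|s]; rewrite ltnNge; apply/negP => le.
by move: nz; rewrite E /= nth_default ?eqxx.
Qed.

(** The leading form is a single monomial, up to a nonzero scalar. *)
Definition mono_top f m := exists2 c, c != 0 & top f = c *: 'X_[m].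

Lemma mono_top_neq0 f m : mono_top f m -> f != 0.
Proof.
case=> c c0 et; rewrite -top_eq0 et; apply/eqP => /(congr1 (mcoeff m)).
by rewrite mcoeffZ mcoeffX eqxx mulr1 mcoeff0; apply/eqP.
Qed.

Lemma mono_top_wdeg f m : mono_top f m -> wdeg f = (wt m).+1.
Proof.
case=> c c0 et; have : m \in msupp (top f) by rewrite et msuppMCX ?mem_head.
by rewrite msupp_top => /andP [_ /eqP].
Qed.

Lemma mono_top1 : mono_top 1 0%MM.
Proof. by exists 1; rewrite ?oner_eq0 // top1 mpolyX0 scale1r. Qed.

Lemma mono_topX m : mono_top 'X_[m] m.
Proof. by exists 1; rewrite ?oner_eq0 // /top whomX lead_coefM lead_coefXn mulr1 lead_coefC scale1r. Qed.

Lemma mono_topM f g m m' : mono_top f m -> mono_top g m' -> mono_top (f * g) (m + m')%MM.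
Proof.
move=> [c c0 ef] [c' c0' eg]; exists (c * c'); first by rewrite mulf_neq0.
by rewrite topM ef eg mpolyXD -scalerAl -scalerAr scalerA.
Qed.

Lemma mono_topD f g m : mono_top f m -> (wdeg g < wdeg f)%N -> mono_top (f + g) m.
Proof.
by case=> c c0 ef lt; exists c; rewrite // topDl.
Qed.

Lemma mono_topN f m : mono_top f m -> mono_top (- f) m.
Proof. by case=> c c0 ef; exists (- c); rewrite ?oppr_eq0 // topN ef scaleNr. Qed.

Lemma mono_top_sign (b : bool) f m : mono_top f m -> mono_top ((-1) ^+ b * f) m.
Proof.
move=> H; case: b; last by rewrite mul1r; exact: H.
by rewrite expr1 mulN1r; exact: mono_topN H.
Qed.

End WeightedTop.

(** * Division along a filtration *)

Section FilteredReduction.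
Variables (R : fieldType) (N : nat) (om : 'I_N -> nat).
Local Notation A := {mpoly R[N]}.
Local Notation top := (top om).
Local Notation wdeg := (wdeg om).
Local Notation mono_top := (mono_top om).
(** What the division algorithm needs to know of a filtration: its leading forms
are spanned by monomials, those of bounded width, and each of them is lifted. *)
Record lead_filtration (F : nat -> A -> Prop) (width_le : 'X_{1..N} -> nat -> Prop) : Prop :=
  LeadFiltration {
  lead_filtC : forall c, F 0%N c%:MP;
  lead_filtD : forall d f g, F d f -> F d g -> F d (f + g);
  lead_filtM : forall d e f g, F d f -> F e g -> F (d + e)%N (f * g);
  lead_filtS : forall d f, F d f -> F d.+1 f;
  lead_filt_exhaust : forall f, exists d, F d f;
  lead_filt_top : forall d f m, F d f -> m \in msupp (top f) -> width_le m d;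
  lead_filt_lift : forall d m, width_le m d -> exists2 h, F d h & mono_top h m
}.

(** Generators whose leading monomials are squarefree and pairwise coprime, and
can be divided out at the cost of one step of the filtration. *)
Record lead_family (F : nat -> A -> Prop) (width_le : 'X_{1..N} -> nat -> Prop)
    (T : eqType) (V : pred T) (p : T -> A) (mm : T -> 'X_{1..N}) : Prop :=
  LeadFamily {
  lead_fam_filt : forall c, V c -> F 1%N (p c);
  lead_fam_top : forall c, V c -> mono_top (p c) (mm c);
  lead_fam_neq0 : forall c, V c -> mm c != 0%MM;
  lead_fam_le1 : forall c i, V c -> (mm c i <= 1)%N;
  lead_fam_coprime : forall c c' i, V c -> V c' -> c != c' ->
    (0 < mm c i)%N -> mm c' i = 0%N;
  lead_fam_div : forall c m d, V c -> (mm c <= m)%MM -> width_le m d ->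
    (0 < d)%N /\ width_le (m - mm c)%MM d.-1
}.

Variables (F : nat -> A -> Prop) (width_le : 'X_{1..N} -> nat -> Prop).
Variables (T : eqType) (V : pred T) (p : T -> A) (mm : T -> 'X_{1..N}).
Hypotheses (filtF : lead_filtration F width_le) (famP : lead_family F width_le V p mm).

Let FC := lead_filtC filtF.
Let FD := lead_filtD filtF.
Let FM := lead_filtM filtF.
Let FS := lead_filtS filtF.
Let Fall := lead_filt_exhaust filtF.
Let F_width := lead_filt_top filtF.
Let width_F := lead_filt_lift filtF.
Let Fp := lead_fam_filt famP.
Let top_p := lead_fam_top famP.
Let mm_neq0 := lead_fam_neq0 famP.
Let mm_le1 := lead_fam_le1 famP.
Let mm_coprime := lead_fam_coprime famP.
Let width_mm := lead_fam_div famP.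

(** Combinations of the p c, for c in cs, with coefficients in G.  Taking for G
everything gives the ideal, taking a step of the filtration gives its part that
is visible in the graded ring. *)
Fixpoint comb (G : A -> Prop) (cs : seq T) (f : A) : Prop :=
  if cs is c :: cs' then exists a g, [/\ G a, comb G cs' g & f = a * p c + g]
  else f = 0.

Local Notation ideal := (comb (fun=> True)).

Lemma combD (G : A -> Prop) cs f g : (forall a b, G a -> G b -> G (a + b)) ->
  comb G cs f -> comb G cs g -> comb G cs (f + g).
Proof.
move=> GD; elim: cs f g => [|c cs IHcs] f g /=; first by move=> -> ->; rewrite addr0.
move=> [a [f' [Ga Gf ->]]] [b [g' [Gb Gg ->]]].
by exists (a + b), (f' + g'); split; [apply: GD | apply: IHcs | ring].
Qed.

Lemma combM (G H : A -> Prop) cs b f : (forall a, G a -> H (b * a)) ->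
  comb G cs f -> comb H cs (b * f).
Proof.
move=> GH; elim: cs f => [|c cs IHcs] f /=; first by move=> ->; rewrite mulr0.
move=> [a [f' [Ga Gf ->]]].
by exists (b * a), (b * f'); split; [apply: GH | apply: IHcs | ring].
Qed.

Lemma comb_sub (G H : A -> Prop) cs f : (forall a, G a -> H a) -> comb G cs f -> comb H cs f.
Proof. by move=> GH Gf; rewrite -[f]mul1r; apply: combM Gf => a /GH; rewrite mul1r. Qed.

Lemma comb0 (G : A -> Prop) cs : G 0 -> comb G cs 0.
Proof.
by move=> G0; elim: cs => //= c cs IHcs; exists 0, 0; split; rewrite // mul0r addr0.
Qed.

Lemma comb_gen (G : A -> Prop) cs c a : G 0 -> c \in cs -> G a -> comb G cs (a * p c).
Proof.
move=> G0 ccs Ga; elim: cs ccs => //= c' cs IHcs; rewrite inE.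
case/predU1P=> [->|/IHcs H]; last by exists 0, (a * p c); rewrite mul0r add0r.
by exists a, 0; split; rewrite ?addr0 //; apply: comb0.
Qed.

Lemma idealB cs f g : ideal cs f -> ideal cs g -> ideal cs (f - g).
Proof.
move=> If Ig; apply: combD => //; rewrite -mulN1r.
exact: (combM (G := fun=> True)).
Qed.

(** The monomial ideal of the leading monomials mm c, through supports. *)
Definition lead_ideal (cs : seq T) (f : A) :=
  forall m, m \in msupp f -> has (fun c => mm c <= m)%MM cs.

Lemma lead_idealD cs f g : lead_ideal cs f -> lead_ideal cs g -> lead_ideal cs (f + g).
Proof.
move=> Jf Jg m /msuppD_le; rewrite mem_cat => /orP [/Jf|/Jg] //.
Qed.

Lemma lead_idealN cs f : lead_ideal cs f -> lead_ideal cs (- f).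
Proof. by move=> Jf m; rewrite (perm_mem (msuppN f)); apply: Jf. Qed.

Lemma lead_ideal_gen cs c a f m : c \in cs -> m = mm c -> lead_ideal cs (f * (a *: 'X_[m])).
Proof.
move=> ccs -> m'; rewrite -scalerAr => /msuppZ_le.
rewrite (perm_mem (msuppMX _ _)) => /mapP [m'' _ ->].
by apply/hasP; exists c; rewrite // lem_addr.
Qed.

Lemma lead_ideal_sub cs cs' f : {subset cs <= cs'} -> lead_ideal cs f -> lead_ideal cs' f.
Proof.
by move=> sub Jf m /Jf /hasP [c /sub ccs' le]; apply/hasP; exists c.
Qed.

Lemma F0 d : F d 0.
Proof. by elim: d => [|d IHd]; [rewrite -mpolyC0 | apply: FS]. Qed.

Lemma FZ d c f : F d f -> F d (c *: f).
Proof. by rewrite -mul_mpolyC -{2}[d]add0n; apply: FM. Qed.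

Lemma FB d f g : F d f -> F d g -> F d (f - g).
Proof. by move=> Ff Fg; apply: FD => //; rewrite -scaleN1r; apply: FZ. Qed.

Lemma comb_F d cs f : all V cs -> comb (F d) cs f -> F d.+1 f.
Proof.
elim: cs f => [|c cs IHcs] f /=; first by move=> _ ->; apply: F0.
case/andP=> Vc Vcs [a [g [Fa Fg ->]]]; apply: FD; last exact: IHcs.
by rewrite -addn1; apply: FM => //; apply: Fp.
Qed.

(** One division step.  The quotients are lifted from monomials of width lowered
by one, so they stay one step down in the filtration. *)
Lemma lead_reduce d cs f : all V cs -> F d f -> f != 0 -> lead_ideal cs (top f) ->
  (0 < d)%N /\ exists2 g, comb (F d.-1) cs g & (wdeg (f - g) < wdeg f)%N.
Proof.
move=> Vcs Ff f0 Jf.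
have d0 : (0 < d)%N.
  have : top f != 0 by rewrite top_eq0.
  rewrite -msupp_eq0; case E: (msupp (top f)) => [//|m s] _.
  have mf : m \in msupp (top f) by rewrite E mem_head.
  have /hasP [c ccs le] := Jf _ mf.
  by have [] := width_mm (allP Vcs c ccs) le (F_width Ff mf).
split=> //.
suff [g Fg [le_g eg]] : exists2 g, comb (F d.-1) cs g &
    (wdeg g <= wdeg f)%N /\ forall m, (wt om m).+1 = wdeg f -> g@_m = (top f)@_m.
  exists g => //; apply: wdegB_lt => // m em; rewrite eg // mcoeff_top em eqxx //.
suff H r : {subset r <= msupp (top f)} -> exists2 g, comb (F d.-1) cs g &
    (wdeg g <= wdeg f)%N /\ forall m, (wt om m).+1 = wdeg f ->
      g@_m = (\sum_(m' <- r) (top f)@_m' *: 'X_[m'])@_m.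
  have [m|g Fg [le_g eg]] := H (msupp (top f)); first by [].
  exists g => //; split=> // m /eg ->; congr (_@__).
  exact: (esym (mpolyE (top f))).
elim: r => [|m r IHr] sub.
  exists 0; first exact/comb0/F0.
  split; first by apply/wdeg_leP => m; rewrite msupp0.
  by move=> m _; rewrite big_nil mcoeff0.
have [|g Fg [le_g eg]] := IHr; first by move=> m' m'r; apply: sub; rewrite inE m'r orbT.
have mf : m \in msupp (top f) by apply: sub; rewrite mem_head.
have /hasP [c ccs le] := Jf _ mf.
have Vc := allP Vcs c ccs.
have [_ /width_F [h Fh th]] := width_mm Vc le (F_width Ff mf).
have thp := mono_topM th (top_p Vc); rewrite submK // in thp.
have wm : (wt om m).+1 = wdeg f by move: mf; rewrite msupp_top => /andP [_ /eqP].
have whp : wdeg (h * p c) = wdeg f by rewrite -wm; apply: mono_top_wdeg.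
have [a a0 et] := thp.
exists (((top f)@_m / a)%:MP * h * p c + g).
  apply: combD Fg; first by move=> x y; apply: FD.
  by apply: comb_gen ccs _; [apply: F0 | rewrite -[d.-1]add0n; apply: FM].
rewrite -mulrA; move: (h * p c) whp et => hp whp et; rewrite mul_mpolyC; split.
  apply: (leq_trans (wdegD om _ g)).
  by rewrite geq_max le_g (leq_trans (wdegZ om _ hp) (eq_leq whp)).
move=> m' em'; rewrite big_cons !mcoeffD eg //; congr (_ + _).
have := congr1 (mcoeff m') et; rewrite mcoeff_top whp em' eqxx mulr1n mcoeffZ => ehp.
by rewrite !mcoeffZ ehp mulrA divfK.
Qed.

(** Dividing by a monomial coprime to the generators does not change divisibility
by one of them. *)
Lemma lead_ideal_cancel c cs f a : a != 0 -> V c -> all V cs -> c \notin cs ->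
  lead_ideal cs (f * (a *: 'X_[mm c])) -> lead_ideal cs f.
Proof.
move=> a0 Vc Vcs ncs J m mf.
have /J /hasP [c' c'cs le] : (mm c + m)%MM \in msupp (f * (a *: 'X_[mm c])).
  by rewrite -scalerAr mcoeff_msupp mcoeffZ mulf_neq0 // mcoeffMX -mcoeff_msupp.
apply/hasP; exists c' => //; apply/mnm_lepP => i.
have := (mnm_lepP le) i; rewrite mnmDE.
have [ci|] := posnP (mm c i); first by rewrite ci.
have cc' : c != c' by apply: contraNneq ncs => ->.
by move=> ci _; rewrite (mm_coprime Vc (allP Vcs _ c'cs) cc' ci).
Qed.

(** Leading forms of the ideal are in the ideal of the leading monomials.  In
a p c + g the leading forms can cancel only if a has its own leading form in the
ideal of the other generators, by coprimality; then a can be made smaller. *)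
Lemma top_comb cs f : uniq cs -> all V cs -> ideal cs f -> lead_ideal cs (top f).
Proof.
elim: cs f => [|c cs IHcs] f.
  by move=> _ _ -> m; rewrite top0 msupp0.
rewrite [uniq _]/= [all _ _]/= => /andP [ncs ucs] /andP [Vc Vcs] [a [g [_ Ig ->]]].
have [b ltb] := ubnP (wdeg a); elim: b a g ltb Ig => // b IHb a g ltb Ig.
have Jg := IHcs g ucs Vcs Ig.
have [c0 c00 etp] := top_p Vc.
have Jap : lead_ideal (c :: cs) (top (a * p c)).
  by rewrite topM etp; apply: (lead_ideal_gen (c := c)); first exact: mem_head.
have Jg' : lead_ideal (c :: cs) (top g).
  by apply: lead_ideal_sub Jg => c' c'cs; rewrite inE c'cs orbT.
have [lt|lt|eq] := ltngtP (wdeg (a * p c)) (wdeg g).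
- by rewrite addrC topDl.
- by rewrite topDl.
have [s0|s0] := eqVneq (top (a * p c) + top g) 0; last first.
  by rewrite topD_eq //; apply: lead_idealD.
have [->|a0] := eqVneq a 0; first by rewrite mul0r add0r.
have Ja : lead_ideal cs (top a).
  apply: (lead_ideal_cancel c00 Vc) => //.
  rewrite -etp -topM -[top _]opprK; apply: lead_idealN.
  by move/eqP: s0; rewrite addrC addr_eq0 => /eqP <-.
have [d Fa] := Fall a.
have [_ [g' Fg' lt]] := lead_reduce Vcs Fa a0 Ja.
have -> : a * p c + g = (a - g') * p c + (g' * p c + g) by ring.
apply: IHb; first by apply: leq_trans lt _.
apply: combD => //; rewrite mulrC.
exact: (combM (G := F d.-1)) Fg'.
Qed.

(** The division algorithm expresses an element of the ideal with coefficients
one step down in the filtration. *)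
Lemma comb_filtered d cs f : uniq cs -> all V cs -> F d f -> ideal cs f -> f != 0 ->
  (0 < d)%N /\ comb (F d.-1) cs f.
Proof.
move=> ucs Vcs; have [b ltb] := ubnP (wdeg f); elim: b f ltb => // b IHb f ltb Ff If f0.
have [d0 [g Fg lt]] := lead_reduce Vcs Ff f0 (top_comb ucs Vcs If).
split=> //; rewrite -[f](subrK g).
apply: (combD _ _ Fg); first by move=> x y; apply: FD.
have [->|fg0] := eqVneq (f - g) 0; first exact/comb0/F0.
apply: (proj2 (IHb _ _ _ _ fg0)).
- exact: leq_trans lt _.
- by apply: FB => //; rewrite -(prednK d0); apply: comb_F Fg.
- by apply: idealB => //; apply: comb_sub Fg.
Qed.

(** A property stable under subtraction of the ideal, and which forces leading
forms to be in the leading ideal, implies membership. *)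
Lemma ideal_of_lead (P : A -> Prop) cs f : uniq cs -> all V cs ->
  (forall g h, P g -> ideal cs h -> P (g - h)) ->
  (forall g, P g -> lead_ideal cs (top g)) -> P f -> ideal cs f.
Proof.
move=> ucs Vcs PB PJ; have [b ltb] := ubnP (wdeg f); elim: b f ltb => // b IHb f ltb Pf.
have [->|f0] := eqVneq f 0; first exact: comb0.
have [d Ff] := Fall f.
have [_ [g Fg lt]] := lead_reduce Vcs Ff f0 (PJ f Pf).
have Ig : ideal cs g by apply: comb_sub Fg.
rewrite -[f](subrK g); apply: combD => //.
by apply: IHb; [apply: leq_trans lt _ | apply: PB].
Qed.

Lemma ideal_regular c cs f : uniq (c :: cs) -> all V (c :: cs) ->
  ideal cs (p c * f) -> ideal cs f.
Proof.
move=> /andP [ncs ucs] /andP [Vc Vcs].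
apply: (ideal_of_lead (P := fun f => ideal cs (p c * f))) => // g.
  move=> h Ig Ih; rewrite mulrBr; apply: idealB => //.
  exact: (combM (G := fun=> True)) Ih.
move/(top_comb ucs Vcs); have [a a0 et] := top_p Vc.
by rewrite topM et mulrC; apply: (lead_ideal_cancel a0 Vc).
Qed.

Lemma lead_idealM cs f g : lead_ideal cs f -> lead_ideal cs (f * g).
Proof.
move=> Jf m /msuppM_le /allpairsP [[m1 m2] /= [/Jf /hasP [c ccs le] _ ->]].
by apply/hasP; exists c => //; apply: lepm_trans le (lem_addr _ _).
Qed.

(** A squarefree monomial divides a power only if it divides the base, and the
powers of the largest monomial do not cancel. *)
Lemma lead_ideal_radical cs f e : all V cs -> lead_ideal cs (f ^+ e) -> lead_ideal cs f.
Proof.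
move=> Vcs; have [b ltb] := ubnP (size (msupp f)).
elim: b f ltb => // b IHb f ltb J.
have [->|f0] := eqVneq f 0; first by move=> m; rewrite msupp0.
have lf := mlead_supp f0.
have /J /hasP [c ccs le] : (mlead f *+ e)%MM \in msupp (f ^+ e).
  by rewrite mcoeff_msupp mleadcX expf_neq0 // mleadc_eq0.
have Jm : lead_ideal cs (f@_(mlead f) *: 'X_[mlead f]).
  move=> m /msuppZ_le; rewrite msuppX inE => /eqP ->; apply/hasP; exists c => //.
  apply/mnm_lepP => i; have := mnm_lepP le i; rewrite mulmnE.
  have := mm_le1 i (allP Vcs c ccs); case: (mlead f i) => [|j]; first by rewrite mul0n.
  by move=> /leq_trans le1 _; apply: le1.
set r := _ *: _ in Jm.
rewrite -[f](subrK r); apply: lead_idealD => //; apply: IHb.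
  rewrite (perm_size (msupp_rem f (mlead f))) size_rem //.
  by case: (msupp f) lf ltb.
have -> : (f - r) ^+ e = f ^+ e - (f ^+ e - (f - r) ^+ e) by ring.
apply: lead_idealD => //; apply: lead_idealN; rewrite subrXX; apply: lead_idealM.
by rewrite opprB addrC subrK.
Qed.

Lemma ideal_radical cs f e : uniq cs -> all V cs -> ideal cs (f ^+ e) -> ideal cs f.
Proof.
move=> ucs Vcs.
apply: (ideal_of_lead (P := fun f => ideal cs (f ^+ e))) => // g.
  move=> h Ig Ih.
  have -> : (g - h) ^+ e = g ^+ e - (g ^+ e - (g - h) ^+ e) by ring.
  apply: idealB => //; rewrite subrXX mulrC; apply: (combM (G := fun=> True)) => //.
  by rewrite opprB addrC subrK.
by move/(top_comb ucs Vcs); rewrite topX; apply: lead_ideal_radical.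
Qed.

Lemma ideal_proper cs : uniq cs -> all V cs -> ~ ideal cs 1.
Proof.
move=> ucs Vcs /(top_comb ucs Vcs); rewrite top1 => /(_ 0%MM).
rewrite msupp1 mem_head => /(_ isT) /hasP [c ccs].
have Vc := allP Vcs c ccs; move: (mm_neq0 Vc) => /eqP nz le; apply: nz.
by apply/mnmP => i; move/mnm_lepP: le => /(_ i); rewrite mnm0E leqn0 => /eqP.
Qed.

End FilteredReduction.

(** * Chains and antichains of cells *)

Section CellPoset.
Variables (n : nat) (rho : {perm 'I_n}).
Local Notation cell := (cell_index n).
Local Notation N := #|{: cell}|.
Implicit Types (p q e : cell) (C : {set cell}) (m : 'X_{1..N}).

(** The two ends of a cell, measured by their ranks under rho. *)
Definition cell_lo p : nat := minn (rho (val p).1) (rho (val p).2).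
Definition cell_hi p : nat := maxn (rho (val p).1) (rho (val p).2).
Local Notation lo := cell_lo.
Local Notation hi := cell_hi.

Lemma lo_lt_hi p : (lo p < hi p)%N.
Proof.
have : (rho (val p).1 : nat) != rho (val p).2.
  by rewrite val_eqE (inj_eq perm_inj) neq_ltn (valP p).
by rewrite /lo /hi; lia.
Qed.

Lemma hi_lt p : (hi p < n)%N.
Proof. by rewrite /hi gtn_max !ltn_ord. Qed.

Lemma cell_of_pair (i j : 'I_n) : (rho i < rho j)%N ->
  exists2 p, (lo p = rho i) /\ (hi p = rho j) &
    val p = (i, j) \/ val p = (j, i).
Proof.
move=> lt_ij; have nij : i != j by apply: contraTneq lt_ij => ->; rewrite ltnn.
case: (ltngtP i j) => [lt|lt|/val_inj e]; last by rewrite e eqxx in nij.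
- by exists (exist _ (i, j) lt); [rewrite /lo /hi /=; lia | left].
- by exists (exist _ (j, i) lt); [rewrite /lo /hi /=; lia | right].
Qed.

Lemma cell_exists i j : (i < j < n)%N -> exists2 p, lo p = i & hi p = j.
Proof.
case/andP=> ij jn; have in' := ltn_trans ij jn.
have [|p [ep1 ep2] _] := @cell_of_pair (rho^-1%g (Ordinal in')) (rho^-1%g (Ordinal jn)).
  by rewrite !permKV.
by exists p; rewrite ?ep1 ?ep2 permKV.
Qed.

Lemma cell_inj p q : lo p = lo q -> hi p = hi q -> p = q.
Proof.
case: p q => [[a b] /= ab] [[c d] /= cd]; rewrite /lo /hi /= => el eh.
apply: val_inj => /=.
have : (rho a = rho c :> nat /\ rho b = rho d :> nat) \/
       (rho a = rho d :> nat /\ rho b = rho c :> nat) by lia.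
case=> [] [/val_inj/perm_inj ea /val_inj/perm_inj eb]; first by rewrite ea eb.
by move: ab; rewrite ea eb; lia.
Qed.

Definition cell_le p q := (lo p <= lo q)%N && (hi p <= hi q)%N.

Definition chain C := [forall p in C, forall q in C, cell_le p q || cell_le q p].

Lemma chainP C : reflect {in C &, forall p q, cell_le p q || cell_le q p} (chain C).
Proof.
apply: (iffP forall_inP) => H p; first by move=> q pC; move: q; apply/forall_inP/H.
by move=> pC; apply/forall_inP => q qC; apply: H.
Qed.

Lemma chain_sub C C' : C \subset C' -> chain C' -> chain C.
Proof. by move=> /subsetP sub /chainP H; apply/chainP => p q /sub pC /sub; apply: H. Qed.

Lemma cell_le_refl p : cell_le p p. Proof. by rewrite /cell_le !leqnn. Qed.

Lemma cell_le_trans q p e : cell_le p q -> cell_le q e -> cell_le p e.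
Proof. rewrite /cell_le; lia. Qed.

Lemma chainU1 e C : chain C -> {in C, forall p, cell_le e p || cell_le p e} -> chain (e |: C).
Proof.
move=> /chainP cC ce; apply/chainP => p q; rewrite !inE.
case/predU1P=> [->|pC] /predU1P [->|qC]; rewrite ?cell_le_refl //.
- exact: ce.
- by rewrite orbC; apply: ce.
- exact: cC.
Qed.

Lemma chain1 p : chain [set p].
Proof. by apply/chainP => q e; rewrite !inE => /eqP-> /eqP->; rewrite cell_le_refl. Qed.

(** Potentials certifying that a chain maximises the sum of the products i j among
the matchings with given ends.  The product i j counts the points (a, b) with
a < i and b < j.  A point can be charged either to the condition a < i or to
b < j; the chain lies on one side of it, which tells how to charge it without
loss along the chain.  Reversed cells, with i > j, are then strictly wasteful. *)
Lemma chain_potential C : chain C -> exists phi psi : nat -> nat,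
  [/\ forall i j, (i <= n)%N -> (j <= n)%N -> (i * j <= phi i + psi j)%N,
      forall i, (phi i <= n * n)%N /\ (psi i <= n * n)%N,
      forall p, (lo p * hi p < phi (hi p) + psi (lo p))%N &
      forall p, p \in C -> (lo p * hi p = phi (lo p) + psi (hi p))%N].
Proof.
move=> /chainP cC.
pose tA (k : 'I_n * 'I_n) := [forall p in C, ~~ ((k.1 < lo p)%N && (hi p <= k.2)%N)].
pose phi i := (\sum_(k : 'I_n * 'I_n) (tA k && (k.1 < i)))%N.
pose psi j := (\sum_(k : 'I_n * 'I_n) (~~ tA k && (k.2 < j)))%N.
have area i j : (i <= n)%N -> (j <= n)%N ->
    (i * j = \sum_(k : 'I_n * 'I_n) ((k.1 < i) && (k.2 < j)))%N.
  move=> ile jle.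
  have cnt a : (a <= n)%N -> (\sum_(x < n) (x < a) = a)%N.
    move=> ale; have := sum1_card 'I_a; rewrite card_ord => {2}<-.
    rewrite (big_ord_widen_cond _ xpredT (fun=> 1%N) ale).
    by rewrite [RHS]big_mkcond; apply: eq_bigr => x _; case: ltnP.
  rewrite -{1}(cnt i ile) -{1}(cnt j jle) big_distrlr /= pair_big.
  by apply: eq_bigr => k _; rewrite mulnb.
have bound (P : pred ('I_n * 'I_n)) : (\sum_k (P k : nat) <= n * n)%N.
  have -> : (n * n = \sum_(k : 'I_n * 'I_n) 1)%N.
    by rewrite sum1_card card_prod card_ord.
  by apply: leq_sum => k _; case: (P k).
exists phi, psi; split.
- move=> i j ile jle; rewrite area // -big_split; apply: leq_sum => k _.
  by case: (tA k) (k.1 < i)%N (k.2 < j)%N => [] [] [].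
- by move=> i; split; apply: bound.
- move=> p; have lh := lo_lt_hi p; have hn := hi_lt p.
  have h1 : ((hi p).-1 < n)%N by lia.
  have l1 : (lo p < n)%N by lia.
  rewrite mulnC area ?(ltnW hn) ?(ltnW l1) // -big_split.
  (* the point charged in vain for the reversed cell *)
  pose k0 := (Ordinal h1, Ordinal l1).
  have Ak0 : tA k0.
    apply/forall_inP => q _; apply/negP => /andP [/= a1 a2].
    by have := lo_lt_hi q; lia.
  rewrite (bigD1 k0) //= [X in (_ < X)%N](bigD1 k0) //= Ak0 ltnn andbF add0n.
  have -> : ((hi p).-1 < hi p)%N by lia.
  rewrite /= addn0 add1n ltnS; apply: leq_sum => k _.
  by case: (tA k) (k.1 < hi p)%N (k.2 < lo p)%N => [] [] [].
- move=> p pC; have lh := lo_lt_hi p; have hn := hi_lt p.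
  rewrite area ?(ltnW hn) //; last by lia.
  rewrite -big_split; apply: eq_bigr => k _ /=.
  have [/forall_inP/(_ p pC)|] := boolP (tA k); first by lia.
  case/forall_inPn => q qC; rewrite negbK => /andP [a1 a2] /=.
  by have := cC _ _ pC qC; rewrite /cell_le; lia.
Qed.

(** The product i j is strictly supermodular, so incomparable cells cannot both
attain the bound. *)
Lemma tight_chain (phi psi : nat -> nat) :
  (forall i j, (i <= n)%N -> (j <= n)%N -> (i * j <= phi i + psi j)%N) ->
  chain [set p | lo p * hi p == phi (lo p) + psi (hi p)]%N.
Proof.
move=> H; apply/chainP => p q; rewrite !inE => /eqP ep /eqP eq.
have := lo_lt_hi p; have := lo_lt_hi q; have := hi_lt p; have := hi_lt q.
move=> h1 h2 h3 h4; have h5 : (lo p <= n)%N by lia.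
have h6 : (lo q <= n)%N by lia.
have := H _ _ h5 (ltnW h1); have := H _ _ h6 (ltnW h2); rewrite /cell_le.
move: (lo p) (hi p) (lo q) (hi q) (phi _) (phi _) (psi _) (psi _) ep eq => a b c d *.
nia.
Qed.

(** A matrix supported on a chain is determined by its row and column sums: at
the first entry where two such matrices differ, both the row and the column
would need a later difference, and these two would be incomparable. *)
Lemma chain_determined C m m' : chain C ->
  (forall p, p \notin C -> m (enum_rank p) = m' (enum_rank p)) ->
  (forall i, \sum_(p in C | lo p == i) m (enum_rank p) =
             \sum_(p in C | lo p == i) m' (enum_rank p))%N ->
  (forall i, \sum_(p in C | hi p == i) m (enum_rank p) =
             \sum_(p in C | hi p == i) m' (enum_rank p))%N ->
  m = m'.
Proof.
move=> /chainP cC off row col.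
pose D := [set p in C | m (enum_rank p) != m' (enum_rank p)].
suff D0 : D = set0.
  apply/mnmP => i; rewrite -[i]enum_valK; set p := enum_val i.
  have [pC|/off //] := boolP (p \in C).
  by apply/eqP; have := in_set0 p; rewrite -D0 inE pC /= => /negbT; rewrite negbK.
apply/eqP/set0Pn => -[p0 p0D].
case: (@arg_minnP _ p0 (mem D) (fun p => lo p + hi p)%N p0D) => p pD minp.
have [pC npm] : p \in C /\ m (enum_rank p) != m' (enum_rank p).
  by move: (pD : p \in D); rewrite inE => /andP [].
have other (f : cell -> nat) :
   (\sum_(q in C | f q == f p) m (enum_rank q) =
    \sum_(q in C | f q == f p) m' (enum_rank q))%N ->
   exists2 q, q \in D & (f q = f p) /\ q != p.
  move=> es; case: (pickP [pred q | [&& q \in D, f q == f p & q != p]]) => [q|none].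
    by case/and3P=> qD /eqP fq qp; exists q.
  case/eqP: npm; move: es; rewrite (bigD1 p) ?pC ?eqxx //= [RHS](bigD1 p) ?pC ?eqxx //=.
  rewrite (eq_bigr (fun q => m' (enum_rank q))); first by move/addIn.
  move=> q /andP [/andP [qC fq] qp]; apply/eqP/negPn/negP => nq.
  by have /negP := negbT (none q); apply; rewrite /= inE qC nq fq qp.
have [q qD [fq qp]] := other lo (row (lo p)).
have [r rD [fr rp]] := other hi (col (hi p)).
have [qC rC] : q \in C /\ r \in C by move: qD rD; rewrite !inE => /andP [-> _] /andP [->].
have nq : hi q != hi p by apply: contraNneq qp => e; apply/eqP/cell_inj.
have nr : lo r != lo p by apply: contraNneq rp => e; apply/eqP/cell_inj.
move: (cC _ _ qC rC) (minp _ qD) (minp _ rD) fq fr nq nr; rewrite /cell_le.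
move: (lo p) (hi p) (lo q) (hi q) (lo r) (hi r); clear; lia.
Qed.

Definition width_le m d := forall C, chain C -> (\sum_(p in C) m (enum_rank p) <= d)%N.

Definition mcells C : 'X_{1..N} := [multinom (enum_val i \in C) : nat | i < N].

Lemma mcellsE C p : mcells C (enum_rank p) = (p \in C).
Proof. by rewrite mnmE enum_rankK. Qed.

Lemma mcells_le C m : (mcells C <= m)%MM = (C \subset [set p | 0 < m (enum_rank p)]%N).
Proof.
apply/mnm_lepP/subsetP => [H p pC|H i].
  by rewrite inE; have := H (enum_rank p); rewrite mcellsE pC.
rewrite mnmE; case: (boolP (_ \in C)) => // /H; rewrite inE enum_valK //.
Qed.

(** Dividing by a set of cells meeting, up to extension, all the chains of the
support lowers the width. *)
Lemma width_sub C m d : (mcells C <= m)%MM ->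
  (forall K, chain K -> K \subset [set p | 0 < m (enum_rank p)]%N ->
     exists2 e, e \in C & chain (e |: K)) ->
  width_le m d -> (0 < d)%N /\ width_le (m - mcells C)%MM d.-1.
Proof.
move=> le hit wdm.
suff H K : chain K -> (\sum_(p in K) (m - mcells C)%MM (enum_rank p) < d)%N.
  split; last by move=> K /H; lia.
  have c0 : chain set0 by apply/chainP => p q; rewrite inE.
  exact: leq_ltn_trans (leq0n _) (H _ c0).
move=> cK; pose S := [set p | 0 < m (enum_rank p)]%N.
have cKS : chain (K :&: S) by apply: chain_sub cK; apply: subsetIl.
have [e eC ce] := hit _ cKS (subsetIr _ _).
have me : (0 < m (enum_rank e))%N.
  by move: le; rewrite mcells_le => /subsetP /(_ e eC); rewrite inE.
apply: leq_trans (wdm _ ce).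
rewrite (bigID (mem S)) /= [X in (_ + X)%N]big1 => [|p /andP [_]]; last first.
  by rewrite inE -leqNgt leqn0 mnmBE => /eqP ->.
rewrite addn0 (eq_bigl (mem (K :&: S))); last by move=> p; rewrite !inE.
have le1 : (\sum_(p in K :&: S) (m - mcells C)%MM (enum_rank p) <=
    \sum_(p in e |: K :&: S) (m - mcells C)%MM (enum_rank p))%N.
  rewrite [X in (_ <= X)%N](bigID (mem (K :&: S))) /=.
  rewrite (eq_bigl (mem (K :&: S)) (P1 := fun i => (i \in e |: K :&: S) && _)) ?leq_addr //.
  by move=> p; rewrite in_setU1 /=; case: (p \in K :&: S); rewrite ?orbT ?andbF.
apply: leq_ltn_trans le1 _.
rewrite (bigD1 e) ?setU11 //= [X in (_ < X)%N](bigD1 e) ?setU11 //=.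
rewrite mnmBE mcellsE eC -addSn; apply: leq_add; first by lia.
by apply: leq_sum => p _; rewrite mnmBE leq_subr.
Qed.

Definition antichain C := forall p q, p \in C -> q \in C -> cell_le p q -> p = q.

Definition minimal_cells m := [set p | (0 < m (enum_rank p))%N &
  [forall q, (0 < m (enum_rank q))%N ==> (cell_le q p) ==> (q == p)]].

Lemma antichain_minimal m : antichain (minimal_cells m).
Proof.
move=> p q; rewrite !inE => /andP [mp _] /andP [_ /forallP /(_ p)].
by rewrite mp /= => /implyP H /H /eqP.
Qed.

Lemma minimal_below m p : (0 < m (enum_rank p))%N ->
  exists2 e, e \in minimal_cells m & cell_le e p.
Proof.
move=> mp; pose P q := (0 < m (enum_rank q))%N && cell_le q p.
have Pp : P p by rewrite /P mp cell_le_refl.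
case: (@arg_minnP _ p P (fun p => lo p + hi p)%N Pp) => e /andP [me lep] mine.
exists e => //; rewrite inE me; apply/forallP => q; apply/implyP => mq.
apply/implyP => leq; have /mine : P q by rewrite /P mq (cell_le_trans leq lep).
by move: leq; rewrite /cell_le => ? ?; apply/eqP/cell_inj; lia.
Qed.

Lemma width_minimal m d : m != 0%MM -> width_le m d ->
  (0 < d)%N /\ width_le (m - mcells (minimal_cells m))%MM d.-1.
Proof.
move=> m0; apply: width_sub.
  by rewrite mcells_le; apply/subsetP => p; rewrite !inE => /andP [].
move=> K cK /subsetP Ksupp; have [->|/set0Pn [p0 p0K]] := eqVneq K set0.
  have [p mp] : exists p, (0 < m (enum_rank p))%N.
    apply/existsP; apply: contra_neqT m0 => /existsPn H; apply/mnmP => i.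
    by have := H (enum_val i); rewrite enum_valK mnm0E lt0n negbK => /eqP.
  by have [e eM _] := minimal_below mp; exists e; rewrite // setU0 chain1.
case: (@arg_minnP _ p0 (mem K) (fun p => lo p + hi p)%N p0K) => p pK minp.
have := Ksupp p pK; rewrite inE => /minimal_below [e eM ep].
exists e => //; apply: chainU1 => // q qK.
have /chainP /(_ p q pK qK) := cK; have := minp q qK.
by move: ep; rewrite /cell_le; lia.
Qed.

Definition line c := [set p | lo p + hi p == c]%N.

Lemma antichain_line c : antichain (line c).
Proof. by move=> p q; rewrite !inE /cell_le => *; apply: cell_inj; lia. Qed.

(** A monotone path from the lowest to the highest cell increases i + j by one at
each step, so it goes through the line; a chain has a gap through which such a
path can be routed. *)
Lemma line_hit c K : (0 < c)%N -> (c + 2 < n.*2)%N -> chain K ->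
  exists2 e, e \in line c & chain (e |: K).
Proof.
move=> c0 cn cK; have cP := chainP _ cK.
have [a1 [a2 [lta lea ltan [la ua]]]] : exists a1 a2,
    [/\ (a1 < a2)%N, (a1 + a2 <= c)%N, (a2 < n)%N &
    (forall p, p \in K -> (lo p + hi p <= c)%N -> (lo p <= a1)%N && (hi p <= a2)%N) /\
    (forall q, q \in K -> (c < lo q + hi q)%N -> (a1 <= lo q)%N && (a2 <= hi q)%N)].
  pose P p := (p \in K) && (lo p + hi p <= c)%N.
  case: (pickP P) => [p0 p0P|none]; last first.
    exists 0%N, 1%N; split=> //; first by lia.
    split=> q qK; first by have := none q; rewrite /P qK => /= ->.
    by have := lo_lt_hi q; lia.
  case: (@arg_maxnP _ p0 P (fun p => lo p + hi p)%N p0P) => p /andP [pK lep] maxp.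
  exists (lo p), (hi p); split=> //; [exact: lo_lt_hi | exact: hi_lt |].
  split=> q qK leq; have := cP _ _ pK qK.
    have /maxp : P q by rewrite /P qK.
    by rewrite /cell_le; lia.
  by rewrite /cell_le; lia.
have [b1 [b2 [ltb leb ltn [ab1 ab2 lb]]]] : exists b1 b2,
    [/\ (b1 < b2)%N, (c <= b1 + b2)%N, (b2 < n)%N &
    [/\ (a1 <= b1)%N, (a2 <= b2)%N &
     forall q, q \in K -> (c < lo q + hi q)%N -> (b1 <= lo q)%N && (b2 <= hi q)%N]].
  pose P p := (p \in K) && (c < lo p + hi p)%N.
  case: (pickP P) => [p0 p0P|none]; last first.
    exists n.-2, n.-1; split; [lia | lia | lia | split; [lia | lia |]].
    by move=> q qK h; have := none q; rewrite /P qK h.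
  case: (@arg_minnP _ p0 P (fun p => lo p + hi p)%N p0P) => p /andP [pK lep] minp.
  have /andP [u1 u2] := ua p pK lep.
  exists (lo p), (hi p); split; [exact: lo_lt_hi|exact: ltnW|exact: hi_lt|split=> //].
  move=> q qK leq; have := cP _ _ pK qK.
  have /minp : P q by rewrite /P qK.
  by rewrite /cell_le; clear; lia.
(* from (a1, a2), raise the second coordinate first, then the first one *)
pose j := minn b2 (c - a1); pose i := (c - j)%N.
have [|e ei ej] := @cell_exists i j; first by rewrite /i /j; clear -ltb leb ltn ab1 ab2 lta lea; lia.
have eij : (i + j = c)%N by rewrite /i /j; clear -ltb leb ltn ab1 ab2 lta lea; lia.
exists e; first by rewrite inE ei ej; apply/eqP.
apply: chainU1 => // q qK; rewrite /cell_le ei ej.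
have [le|lt] := leqP (lo q + hi q) c.
  have := la q qK le.
  by rewrite /i /j; clear -ltb leb ltn ab1 ab2 lta lea; lia.
have := lb q qK lt.
by rewrite /i /j; clear -ltb leb ltn ab1 ab2 lta lea; lia.
Qed.

End CellPoset.

(** * Leading coefficients after substitution *)

Section CoefTop.
Variables (R : idomainType) (N : nat) (om : 'I_N -> nat).
Variables (B : comNzRingType) (c : {rmorphism R -> B}) (h : 'I_N -> {poly B}) (y : 'I_N -> B).
Hypothesis hy : forall i, (size (h i) <= (om i).+1)%N /\ (h i)`_(om i) = y i.

Lemma coef_mul_top (F G : {poly B}) w w' : (size F <= w.+1)%N -> (size G <= w'.+1)%N ->
  (size (F * G)%R <= (w + w').+1)%N /\ (F * G)`_(w + w') = F`_w * G`_w'.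
Proof.
move=> sF sG; split.
  apply: leq_trans (size_polyMleq _ _) _; lia.
rewrite coefM; have lt : (w < (w + w').+1)%N by lia.
rewrite (bigD1 (Ordinal lt)) //= addKn big1 ?addr0 // => j.
rewrite -val_eqE /= => jw; case: (ltngtP j w) jw => // lt' _.
  by rewrite [G`_ _]nth_default ?mulr0 //; apply: leq_trans sG _; lia.
by rewrite nth_default ?mul0r //; apply: leq_trans sF _.
Qed.

Lemma coef_mmap1_top (m : 'X_{1..N}) :
  (size (mmap1 h m) <= (wt om m).+1)%N /\ (mmap1 h m)`_(wt om m) = mmap1 y m.
Proof.
rewrite /mmap1 /wt; elim/big_rec3: _ => [|i x z w _ [sz ez]].
  by rewrite size_poly1 coef1.
have [s1 e1] := hy i.
have [sx ex] : (size (h i ^+ m i)%R <= (om i * m i).+1)%N /\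
    (h i ^+ m i)`_(om i * m i) = y i ^+ m i.
  elim: (m i) => [|j [sj ej]]; first by rewrite muln0 !expr0 size_poly1 coef1.
  rewrite mulnS !exprS -ej -e1; exact: coef_mul_top.
by rewrite -ex -ez; apply: coef_mul_top.
Qed.

(** If the images of the variables have prescribed leading coefficients y, then
the coefficient of a substituted polynomial in the largest weight is obtained by
substituting y in the leading form. *)
Lemma coef_mmap_top (f : {mpoly R[N]}) w : (wdeg om f <= w.+1)%N ->
  (mmap (polyC \o c) h f)`_w =
  \sum_(m <- msupp f | wt om m == w) c f@_m * mmap1 y m.
Proof.
move=> /wdeg_leP lew; rewrite /mmap coef_sum [RHS]big_mkcond.
apply: eq_big_seq => m mf; rewrite /= coefCM.
have [sz <-] := coef_mmap1_top m.
have := lew m mf; rewrite ltnS leq_eqVlt => /orP [/eqP <-|lt]; first by rewrite eqxx.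
by rewrite (ltn_eqF lt) nth_default ?mulr0 //; apply: leq_trans sz _.
Qed.

End CoefTop.

(** * The filtration by number of Pfaffians *)

(** The coefficients of t ^ d in the homogeneous coordinate ring. *)
HB.lock Definition OGr_filt (k : closedFieldType) (n d : nat) (f : cell_ring k n) : Prop :=
  in_OGr (f%:P * 'X^d).

Section OGrFiltration.
Variables (k : closedFieldType) (n : nat).
Local Notation A := (cell_ring k n).
Implicit Types (f g : A) (s : seq 'I_n).

Local Notation filt := (@OGr_filt k n).

Lemma filtE d f : filt d f = in_OGr (f%:P * 'X^d).
Proof. by rewrite OGr_filt.unlock. Qed.

Lemma filtC c : filt 0 c%:MP.
Proof. by rewrite filtE expr0 mulr1; apply: OGr_const. Qed.

Lemma filtD d f g : filt d f -> filt d g -> filt d (f + g).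
Proof.
rewrite !filtE polyCD mulrDl; exact: OGr_add.
Qed.

Lemma filtM d e f g : filt d f -> filt e g -> filt (d + e) (f * g).
Proof.
rewrite !filtE => Hf /(OGr_mul Hf); congr in_OGr; rewrite polyCM exprD; ring.
Qed.

Lemma filt0 d : filt d 0.
Proof.
rewrite filtE; have -> : 0%:P * 'X^d = ((0 : k)%:MP)%:P :> {poly A}.
  by rewrite mpolyC0 polyC0 mul0r; reflexivity.
exact: OGr_const.
Qed.

Lemma filtN d f : filt d f -> filt d (- f).
Proof.
move=> Ff; rewrite -mulN1r -[d]add0n; apply: filtM => //.
by rewrite -mpolyC1 -mpolyCN; apply: filtC.
Qed.

Lemma filt_sum d (I : Type) (r : seq I) (P : pred I) (F : I -> A) :
  (forall i, P i -> filt d (F i)) -> filt d (\sum_(i <- r | P i) F i).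
Proof. by move=> FF; elim/big_ind: _ => //; [apply: filt0 | apply: filtD]. Qed.

Definition cell_pf s : A := pf (cell_mx k n) s.

Lemma cell_mxC i j : cell_mx k n i j = - cell_mx k n j i.
Proof.
rewrite !mxE; case: insubP => [p /= lt _|]; last first.
  by case: insubP => [p _ _ _|_ _]; rewrite ?opprK ?oppr0.
by rewrite insubN ?opprK //= -leqNgt ltnW.
Qed.

Lemma spinor_cell_lpf (x0 : 'I_n) (I : {set 'I_n}) :
  spinor_cell k I = cell_pf (enum (~: [set rev_ord i | i in I])).
Proof.
rewrite /spinor_cell; set S := ~: _; apply: (Pf_pf (x0 := x0)); first by rewrite -cardE.
by move=> i j _; rewrite mxE !(enum_val_nth x0).
Qed.

Lemma filt_lpf (x0 : 'I_n) s : uniq s -> ~~ odd (size s) -> filt 1 (cell_pf s).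
Proof.
move=> us es; pose S := [set i in s].
have pS : perm_eq s (enum S).
  by apply: uniq_perm => //; [apply: enum_uniq | move=> i; rewrite mem_enum inE].
have [b] := alternating_perm (alternating_pf cell_mxC) pS; rewrite -!/(cell_pf _) => ->.
pose I := [set rev_ord i | i in ~: S].
have eI : ~: [set rev_ord i | i in I] = S.
  apply/setP => i; rewrite in_setC -{1}[i]rev_ordK !mem_imset ?in_setC ?negbK //;
    exact: rev_ord_inj.
have oI : odd #|I| = odd n.
  have -> : odd n = odd (#|S| + #|~: S|) by rewrite cardsC card_ord.
  rewrite oddD card_imset; last exact: rev_ord_inj.
  have -> : #|S| = size s by rewrite cardE (perm_size pS).
  by rewrite (negPf es).
have := OGr_spinor k oI; rewrite (spinor_cell_lpf x0) eI => H.
rewrite -[1%N]add0n; apply: filtM; last by rewrite filtE expr1 mulrC.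
by case: b; [rewrite expr1 -mpolyC1 -mpolyCN | rewrite expr0 -mpolyC1]; apply: filtC.
Qed.

Lemma filtS (x0 : 'I_n) d f : filt d f -> filt d.+1 f.
Proof.
move=> Ff; rewrite -[f]mulr1 -addn1; apply: filtM => //.
exact: (filt_lpf x0 (s := [::])).
Qed.

Lemma filt_le (x0 : 'I_n) d e f : (d <= e)%N -> filt d f -> filt e f.
Proof. by move=> /subnK <-; elim: (e - d)%N => // c IHc /IHc; apply: filtS. Qed.

Lemma filt_all (x0 : 'I_n) f : exists d, filt d f.
Proof.
elim/mpolyind: f => [|c m f _ _ [d Ff]]; first by exists 0%N; apply: filt0.
have FX : exists e, filt e 'X_[m].
  rewrite mpolyXE_id; elim/big_ind: _ => [|x y [d1 F1] [d2 F2]|i _].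
  - by exists 0%N; rewrite -mpolyC1; apply: filtC.
  - by exists (d1 + d2)%N; apply: filtM.
  elim: (m i) => [|j [e Fe]]; first by exists 0%N; rewrite expr0 -mpolyC1; apply: filtC.
  exists (1 + e)%N; rewrite exprS; apply: filtM => //.
  rewrite -[i]enum_valK; case: (enum_val i) => -[a b] /= lt.
  have -> : 'X_(enum_rank (exist _ (a, b) lt)) = cell_pf [:: a; b].
    rewrite /cell_pf !pf_cons /= mulr1 subr0 mxE insubT.
    by congr 'X_(enum_rank _); apply: val_inj.
  apply: (filt_lpf x0) => //=; rewrite inE andbT.
  by apply: contraTneq lt => ->; rewrite ltnn.
have [e Fe] := FX; exists (maxn e d); apply: filtD.
  apply: (filt_le x0 (leq_maxl _ _)); rewrite -mul_mpolyC -[e]add0n.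
  by apply: filtM => //; apply: filtC.
exact: (filt_le x0 (leq_maxr _ _)).
Qed.

Lemma filt_coef F : in_OGr F -> forall d, filt d F`_d.
Proof.
elim=> {F} [c|I oI|F G _ IF _ IG|F G _ IF _ IG] d.
- by rewrite coefC; case: eqP => [->|_]; [apply: filtC | apply: filt0].
- rewrite mulrC coefCM coefX; case: eqP => [->|_]; last by rewrite mulr0; apply: filt0.
  by rewrite mulr1 filtE expr1 mulrC; apply: OGr_spinor.
- by rewrite coefD; apply: filtD.
- rewrite coefM; apply: filt_sum => j _.
  by rewrite -{1}[d](subnKC (leq_ord j)); apply: filtM.
Qed.

End OGrFiltration.

(** * Leading forms have bounded width *)

Lemma monomial_pair (E : comNzRingType) (a b : E) w w' :
  'X%:P * ((a%:P%:P * 'X^w) * (b%:P%:P * 'X^w')) =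
  ((a * b)%:P * 'X)%:P * 'X^(w + w') :> {poly {poly E}}.
Proof.
rewrite !polyCM exprD; move: 'X%:P 'X^w 'X^w' (a%:P%:P) (b%:P%:P) => x y z c d.
ring.
Qed.

Lemma monomial_swap (E : comNzRingType) (a b : E) w w' :
  (a%:P * 'X)%:P * 'X^w - (b%:P * 'X)%:P * 'X^w' =
  ((- b)%:P * 'X)%:P * 'X^w' - ((- a)%:P * 'X)%:P * 'X^w :> {poly {poly E}}.
Proof.
have opp c e : ((- c)%:P * 'X)%:P * 'X^e = - ((c%:P * 'X)%:P * 'X^e) :> {poly {poly E}}.
  by rewrite polyCN mulNr polyCN mulNr.
by rewrite (opp a w) (opp b w') opprK addrC.
Qed.

Section InnerDegree.
Variable R : comNzRingType.
Implicit Types F G : {poly {poly R}}.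

(** For polynomials in an outer variable with coefficients in R[s]: the degree in
s is at most d. *)
Definition sdeg d F := forall w, (size (F`_w)%R <= d.+1)%N.

Lemma sdegB d F G : sdeg d F -> sdeg d G -> sdeg d (F - G).
Proof.
move=> sF sG w; rewrite coefB (leq_trans (size_polyD _ _)) //.
by rewrite size_polyN geq_max sF sG.
Qed.

Lemma sdeg_sum d I (r : seq I) (P : pred I) (F : I -> {poly {poly R}}) :
  (forall i, P i -> sdeg d (F i)) -> sdeg d (\sum_(i <- r | P i) F i).
Proof.
move=> sF; elim/big_rec: _ => [|i G Pi sG] w; first by rewrite coef0 size_poly0.
by rewrite coefD (leq_trans (size_polyD _ _)) // geq_max sG sF.
Qed.

Lemma sdegM d e F G : sdeg d F -> sdeg e G -> sdeg (d + e) (F * G).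
Proof.
move=> sF sG w; rewrite coefM; elim/big_rec: _ => [|i H _ sH]; first by rewrite size_poly0.
rewrite (leq_trans (size_polyD _ _)) // geq_max sH andbT.
apply: leq_trans (size_polyMleq _ _) _.
by have := sF i; have := sG (w - i)%N; lia.
Qed.

Lemma sdeg_le d e F : (d <= e)%N -> sdeg d F -> sdeg e F.
Proof. by move=> le sF w; apply: leq_trans (sF w) _; rewrite ltnS. Qed.

Lemma sdeg0 d : sdeg d 0.
Proof. by move=> w; rewrite coef0 size_poly0. Qed.

Lemma sdegD d F G : sdeg d F -> sdeg d G -> sdeg d (F + G).
Proof.
by move=> sF sG w; rewrite coefD (leq_trans (size_polyD _ _)) // geq_max sF sG.
Qed.

Lemma sdegCX (b : R) w : sdeg 0 (b%:P%:P * 'X^w).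
Proof.
move=> w'; rewrite coefCM coefXn; case: eqP; rewrite ?mulr1 ?mulr0 ?size_poly0 //.
by rewrite size_polyC leq_b1.
Qed.

Lemma sdeg1 : sdeg 0 1.
Proof. by have := sdegCX 1 0; rewrite !polyC1 expr0 mulr1. Qed.

Lemma sdegX : sdeg 1 'X%:P.
Proof. by move=> w; rewrite coefC; case: eqP => _; rewrite ?size_polyX ?size_poly0. Qed.

End InnerDegree.

Section WidthBound.
Variables (k : closedFieldType) (n : nat) (rho : {perm 'I_n}) (x0 : 'I_n).
Local Notation cell := (cell_index n).
Local Notation N := #|{: cell}|.
Local Notation A := (cell_ring k n).
Local Notation filt := (@OGr_filt k n).
Local Notation lo := (cell_lo rho).
Local Notation hi := (cell_hi rho).
Implicit Types (p : cell) (f : A) (m : 'X_{1..N}).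

(** Minus the product of the ranks, shifted to be positive. *)
Definition cell_weight p := ((n * n).*2 - lo p * hi p)%N.
Definition cell_om (i : 'I_N) := cell_weight (enum_val i).
Local Notation top := (top cell_om).
Local Notation wdeg := (wdeg cell_om).

Section Degeneration.
Variables (phi psi : nat -> nat).
Hypotheses (le_phi_psi : forall i j, (i <= n)%N -> (j <= n)%N -> (i * j <= phi i + psi j)%N)
  (bnd : forall i, (phi i <= n * n)%N /\ (psi i <= n * n)%N)
  (lt_phi_psi : forall p, (lo p * hi p < phi (hi p) + psi (lo p))%N).

Let T := [set p | lo p * hi p == phi (lo p) + psi (hi p)]%N.
Local Notation idx := (cell + ('I_n + 'I_n))%type.
Local Notation M := #|{: idx}|.
Local Notation E := {mpoly k[M]}.
Local Notation B := {poly E}.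

Let mx p : 'X_{1..M} := U_(enum_rank (inl p : idx))%MM.
Let ma i : 'X_{1..M} := U_(enum_rank (inr (inl i) : idx))%MM.
Let mb i : 'X_{1..M} := U_(enum_rank (inr (inr i) : idx))%MM.
Let mu i := (n * n - phi i)%N.
Let nu i := (n * n - psi i)%N.
Let u i : {poly B} := 'X_[ma i]%:P%:P * 'X^(mu (rho i)).
Let v i : {poly B} := 'X_[mb i]%:P%:P * 'X^(nu (rho i)).
Let S : {poly B} := 'X%:P.

Let base p : {poly B} :=
  if p \in T then 0 else 'X_[mx p]%:P%:P * 'X^(cell_weight p).
Let gen p := base p + S * (u (val p).1 * v (val p).2 - v (val p).1 * u (val p).2).

Let small p := (if (rho (val p).1 < rho (val p).2)%N then (val p).1 else (val p).2).
Let large p := (if (rho (val p).1 < rho (val p).2)%N then (val p).2 else (val p).1).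
Let sgn p : k := (-1) ^+ ~~ (rho (val p).1 < rho (val p).2)%N.
Let mon p := if p \in T then (ma (small p) + mb (large p))%MM else mx p.
Let lim p : B := ((if p \in T then sgn p else 1) *: 'X_[mon p])%:P * 'X^(p \in T).

Let small_lo p : rho (small p) = lo p :> nat.
Proof. by rewrite /small /cell_lo; case: ltnP => ?; lia. Qed.

Let large_hi p : rho (large p) = hi p :> nat.
Proof. by rewrite /large /cell_hi; case: ltnP => ?; lia. Qed.

(** In leading forms, the cells where the potentials are tight are replaced, up to
sign, by s a_i b_j, and the others are unchanged. *)
Let gen_top p : (size (gen p) <= (cell_weight p).+1)%N /\ (gen p)`_(cell_weight p) = lim p.
Proof.
have lh := lo_lt_hi rho p; have hn := hi_lt rho p.
have H1 := @le_phi_psi (lo p) (hi p) _ (ltnW hn); have H2 := lt_phi_psi p.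
have [B1 B2] := (bnd (lo p), bnd (hi p)).
have w1 : (mu (lo p) + nu (hi p) <= cell_weight p)%N.
  by rewrite /mu /nu /cell_weight; lia.
have w2 : (mu (hi p) + nu (lo p) < cell_weight p)%N.
  by rewrite /mu /nu /cell_weight; lia.
have w3 : (mu (lo p) + nu (hi p) == cell_weight p) = (p \in T).
  by rewrite inE /mu /nu /cell_weight; apply/eqP/eqP; lia.
(* the two monomials of weights mu i + nu j, for i, j in increasing and in
   decreasing order of ranks *)
have -> : gen p = base p + ((sgn p *: 'X_[ma (small p) + mb (large p)])%:P * 'X)%:P *
     'X^(mu (lo p) + nu (hi p)) - ((sgn p *: 'X_[ma (large p) + mb (small p)])%:P * 'X)%:P *
     'X^(mu (hi p) + nu (lo p)).
  rewrite -small_lo -large_hi /gen -addrA; congr (_ + _).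
  rewrite mulrBr [v _ * u _]mulrC !monomial_pair -!mpolyXD.
  rewrite /sgn /small /large; case: ltnP => _; first by rewrite expr0 !scale1r.
  rewrite expr1; rewrite 2!scaleN1r; exact: monomial_swap.
have tpX (b : B) w e : (w <= e)%N ->
    (size (b%:P * 'X^w)%R <= e.+1)%N /\ (b%:P * 'X^w)`_e = if w == e then b else 0.
  move=> le; split; first by rewrite (leq_trans (size_polyMleq _ _)) // size_polyXn size_polyC; lia.
  by rewrite coefCM coefXn eq_sym; case: eqP; rewrite ?mulr1 ?mulr0.
have [s1 c1] := tpX ((sgn p *: 'X_[ma (small p) + mb (large p)])%:P * 'X) _ _ w1.
have [s2 c2] := tpX ((sgn p *: 'X_[ma (large p) + mb (small p)])%:P * 'X) _ _ (ltnW w2).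
rewrite w3 in c1; rewrite (ltn_eqF w2) in c2.
have [s3 c3] : (size (base p) <= (cell_weight p).+1)%N /\
    (base p)`_(cell_weight p) = if p \in T then 0 else 'X_[mx p]%:P.
  rewrite /base; case: (p \in T); first by rewrite size_poly0 coef0.
  by have := tpX 'X_[mx p]%:P _ _ (leqnn (cell_weight p)); rewrite eqxx.
split; first by rewrite !(leq_trans (size_polyD _ _), size_polyN, geq_max) ?s1 ?s2 ?s3.
rewrite !coefD coefN c1 c2 c3 /lim /mon; case: (p \in T).
  by rewrite add0r subr0 expr1.
by rewrite addr0 subr0 scale1r expr0 mulr1.
Qed.

Let theta m : 'X_{1..M} := (\sum_p mon p *+ m (enum_rank p))%MM.
Let tdeg m := (\sum_(p in T) m (enum_rank p))%N.

(** No cancellation can occur in the limit: the exponents of the a_i and b_j are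
the row and column sums of a matrix supported on a chain. *)
Let theta_inj m m' : theta m = theta m' -> m = m'.
Proof.
move=> e; have co x : (\sum_p m (enum_rank p) * mon p (enum_rank x) =
    \sum_p m' (enum_rank p) * mon p (enum_rank x))%N.
  have thE g : theta g (enum_rank x) = (\sum_p g (enum_rank p) * mon p (enum_rank x))%N.
    by rewrite mnm_sumE; apply: eq_bigr => p _; rewrite mulmnE mulnC.
  by rewrite -!thE e.
have mon0 p q : mon p (enum_rank (inl q : idx)) = (p \notin T) && (p == q).
  rewrite /mon; case: (p \in T); rewrite ?mnmDE !mnm1E !(inj_eq enum_rank_inj) //.
have monl p i : mon p (enum_rank (inr (inl i) : idx)) = (p \in T) && (lo p == rho i).
  rewrite /mon; case: (p \in T); rewrite ?mnmDE !mnm1E !(inj_eq enum_rank_inj) //=.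
  by rewrite -small_lo addn0 val_eqE (inj_eq perm_inj).
have monr p i : mon p (enum_rank (inr (inr i) : idx)) = (p \in T) && (hi p == rho i).
  rewrite /mon; case: (p \in T); rewrite ?mnmDE !mnm1E !(inj_eq enum_rank_inj) //=.
  by rewrite -large_hi add0n val_eqE (inj_eq perm_inj).
have cond (g : 'X_{1..N}) (P : pred cell) x : (forall p, mon p (enum_rank x) = P p) ->
    (\sum_p g (enum_rank p) * mon p (enum_rank x) = \sum_(p | P p) g (enum_rank p))%N.
  move=> eP; rewrite [RHS]big_mkcond; apply: eq_bigr => p _; rewrite eP.
  by case: (P p); rewrite ?muln1 ?muln0.
apply: (@chain_determined n rho T _ _ (tight_chain rho le_phi_psi)) => [p pT|i|i].
- have := co (inl p); rewrite (bigD1 p) //= [RHS](bigD1 p) //= !mon0 pT eqxx !muln1.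
  rewrite !big1 ?addn0 // => q /negPf qp; rewrite mon0 qp andbF muln0 //.
- case: (pickP [pred p | lo p == i]) => [p0 /eqP /= <-|none]; last first.
    by rewrite !big_pred0 // => p; have /= := none p; case: eqP; rewrite ?andbF.
  have := co (inr (inl (small p0))).
  by rewrite !(cond _ _ _ (fun p => monl p _)) small_lo.
- case: (pickP [pred p | hi p == i]) => [p0 /eqP /= <-|none]; last first.
    by rewrite !big_pred0 // => p; have /= := none p; case: eqP; rewrite ?andbF.
  have := co (inr (inr (large p0))).
  by rewrite !(cond _ _ _ (fun p => monr p _)) large_hi.
Qed.

Let mmap1_lim m : exists2 c : k, c != 0 &
  mmap1 (fun i => lim (enum_val i)) m = (c *: 'X_[theta m])%:P * 'X^(tdeg m).
Proof.
exists (\prod_p (if p \in T then sgn p else 1) ^+ m (enum_rank p)).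
  apply/prodf_neq0 => p _; rewrite expf_neq0 //; case: (p \in T); rewrite ?oner_eq0 //.
  by rewrite /sgn signr_eq0.
rewrite /mmap1 (reindex (@enum_rank _)) /=; last exact: onW_bij (@enum_rank_bij _).
rewrite /theta /tdeg big_mkcond /=.
elim: (index_enum _) => [|p r IHr].
  by rewrite !big_nil mpolyX0 scale1r expr0 mulr1.
rewrite !big_cons IHr enum_rankK {1}/lim exprMn -rmorphXn /= exprZn mpolyXn -exprM.
rewrite mulrACA -polyCM -scalerAl -scalerAr scalerA -mpolyXD -exprD.
congr (_ * 'X^_).
by case: (p \in T); rewrite ?mul1n ?mul0n ?add0n.
Qed.

Let Psi : {rmorphism A -> {poly B}} :=
  mmap (polyC \o (polyC \o @mpolyC M k)) (fun i => gen (enum_val i)).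

Lemma sdeg_lpf s : sdeg 1 (Psi (cell_pf k s)).
Proof.
pose z i j := Psi (cell_mx k n i j) - S * (u i * v j - v i * u j).
have sz i j : sdeg 0 (z i j).
  have PX p : Psi 'X_(enum_rank p) = gen p.
    by rewrite /Psi /= mmapX mmap1U enum_rankK.
  have sbase p : sdeg 0 (base p).
    by rewrite /base; case: ifP => _; [exact: sdeg0 | exact: sdegCX].
  rewrite /z mxE; case: insubP => [p _ ep|nij].
    by rewrite /cell_var PX /gen ep /= addrK.
  case: insubP => [p _ ep|nji].
    rewrite /cell_var rmorphN PX /gen ep /=.
    have -> : u j * v i - v j * u i = - (u i * v j - v i * u j).
      by rewrite opprB [u j * _]mulrC [v j * _]mulrC.
    by rewrite mulrN opprB [S * _ - _]addrC addrK -sub0r; apply: sdegB => //; apply: sdeg0.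
  suff -> : i = j by rewrite rmorph0 [v j * _]mulrC subrr mulr0 subr0; exact: sdeg0.
  by apply: val_inj; move: nij nji => /=; lia.
rewrite /cell_pf rmorph_pf.
rewrite (@pf_ext _ _ _ (fun i j => z i j + S * (u i * v j - v i * u j))); last first.
  by move=> i j; rewrite subrK.
have su i : sdeg 0 (u i) by exact: sdegCX.
have sv i : sdeg 0 (v i) by exact: sdegCX.
have s1 := @sdeg1 E.
have sM (F G : {poly B}) : sdeg 0 F -> sdeg 0 G -> sdeg 0 (F * G) by apply: sdegM.
have sB (F G : {poly B}) : sdeg 0 F -> sdeg 0 G -> sdeg 0 (F - G) by apply: sdegB.
have spf t : sdeg 0 (pf z t).
  exact: (@pf_closed _ _ (sdeg 0) z t sB sM s1 sz).
have sS : sdeg 1 S := @sdegX E.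
rewrite pf_rank2; apply: sdegB; first exact: sdeg_le (leq0n _) (spf _).
have s0 := @sdeg0 E 0.
rewrite -[1%N]addn0; apply: (sdegM sS).
apply: (@contr_closed _ _ (sdeg 0) _ _ _ sB sM s0 sv) => t.
exact: (@contr_closed _ _ (sdeg 0) _ _ _ sB sM s0 su).
Qed.

Lemma sdeg_OGr F : in_OGr F -> forall d, sdeg d (Psi F`_d).
Proof.
elim=> {F} [c|I oI|F G _ IF _ IG|F G _ IF _ IG] d.
- rewrite coefC; case: (d == 0%N); last by rewrite rmorph0; apply: sdeg0.
  rewrite /Psi /= mmapC; apply: (sdeg_le (leq0n d)).
  have := @sdegCX E c%:MP_[M] 0%N; rewrite expr0 mulr1; exact.
- rewrite mulrC coefCM coefX; case: eqP => [->|_]; last first.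
    by rewrite mulr0 rmorph0; apply: sdeg0.
  by rewrite mulr1 (spinor_cell_lpf k x0); apply: sdeg_lpf.
- by rewrite coefD rmorphD; exact: (sdegD (IF d) (IG d)).
- rewrite coefM rmorph_sum; apply: sdeg_sum => j _; rewrite rmorphM.
  by rewrite -{1}[d](subnKC (leq_ord j)); exact: (sdegM (IF j) (IG (d - j)%N)).
Qed.

Lemma filt_tight d f m : filt d f -> m \in msupp (top f) -> (tdeg m <= d)%N.
Proof.
rewrite filtE => /sdeg_OGr /(_ d); rewrite coefCM coefXn eqxx mulr1 => sPf.
rewrite msupp_top => /andP [mf /eqP wm].
have ePsi := @coef_mmap_top k N cell_om B (polyC \o @mpolyC M k) _ _
  (fun i => gen_top (enum_val i)) f (wt cell_om m).
rewrite wm in ePsi; have {}ePsi := ePsi (leqnn _).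
rewrite leqNgt; apply/negP => lt.
have : (Psi f)`_(wt cell_om m)`_(tdeg m)@_(theta m) = 0.
  by rewrite [_`_(tdeg m)]nth_default ?mcoeff0 //; apply: leq_trans (sPf _) lt.
have co m' : exists2 c : k, c != 0 & ((polyC \o @mpolyC M k) f@_m' *
    mmap1 (fun i => lim (enum_val i)) m')`_(tdeg m)@_(theta m) = (f@_m' * c) *+ (m' == m).
  have [c c0 ->] := mmap1_lim m'; exists c => //.
  rewrite /= mulrA -polyCM mul_mpolyC scalerA coefCM coefXn mulr_natr mcoeffMn mcoeffZ mcoeffX.
  have [->|ne] := eqVneq m' m; first by rewrite !eqxx mulr1.
  by rewrite (negPf (contra_neq (@theta_inj _ _) ne)) mulr0 mul0rn.
rewrite /Psi /= ePsi coef_sum raddf_sum /= => /eqP; apply/negP.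
rewrite big_mkcond (bigD1_seq m) ?msupp_uniq //= eqxx big1 => [|m' ne].
  have [c c0 ->] := co m; rewrite eqxx addr0 mulr1n mulf_neq0 //.
  by rewrite -mcoeff_msupp.
by case: ifP => // _; have [c _ ->] := co m'; rewrite (negPf ne).
Qed.

End Degeneration.

Theorem filt_width d f m : filt d f -> m \in msupp (top f) -> width_le rho m d.
Proof.
move=> Ff mf C cC; have [phi [psi [H1 H2 H3 H4]]] := chain_potential cC.
apply: leq_trans (filt_tight H1 H2 H3 Ff mf).
rewrite [X in (_ <= X)%N](bigID (mem C)) /=.
rewrite [X in (_ <= X + _)%N](eq_bigl (mem C)) ?leq_addr // => p.
by rewrite inE; apply/andP/idP => [[] //|pC]; split => //; apply/eqP/H4.
Qed.

End WidthBound.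

(** * Leading monomials of Pfaffians *)

Lemma contr_rcons (R : comNzRingType) (I : Type) (w : I -> R) g s l :
  contr w g (rcons s l) =
  (-1) ^+ size s * (w l * g s) + contr w (fun t => g (rcons t l)) s.
Proof.
elim: s g => [|j s IHs] g /=; first by rewrite mul1r addr0 subr0.
by rewrite IHs exprS; ring.
Qed.

Section PfaffianLead.
Variables (k : closedFieldType) (n : nat) (rho : {perm 'I_n}) (x0 : 'I_n).
Local Notation cell := (cell_index n).
Local Notation N := #|{: cell}|.
Local Notation filt := (@OGr_filt k n).
Local Notation lo := (cell_lo rho).
Local Notation hi := (cell_hi rho).
Local Notation om := (cell_om rho).
Local Notation wdeg := (wdeg om).
Local Notation mono_top := (mono_top om).
Local Notation X := (cell_mx k n).
Local Notation lpf := (cell_pf k).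
Local Notation W s := (wdeg (lpf s)).
Implicit Types (p : cell) (s t : seq 'I_n) (C : {set cell}) (m : 'X_{1..N}).

Definition rlt (i j : 'I_n) := (rho i < rho j)%N.
Let w (i j : 'I_n) := ((n * n).*2 - rho i * rho j)%N.

Lemma wt_cell p : wt om U_(enum_rank p) = cell_weight rho p.
Proof. by rewrite wtU /cell_om enum_rankK. Qed.

Lemma cell_mx_lead (i j : 'I_n) p : lo p = rho i -> hi p = rho j ->
  mono_top (X i j) U_(enum_rank p).
Proof.
move=> el eh; have lt : (rho i < rho j)%N by rewrite -el -eh lo_lt_hi.
have [q [el' eh'] eq] := cell_of_pair lt.
have -> : p = q by apply: (@cell_inj _ rho); rewrite ?el ?el' ?eh ?eh'.
have Xv (a b : 'I_n) : val q = (a, b) -> X a b = 'X_(enum_rank q).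
  move=> eab; rewrite mxE insubT -eab; first exact: (valP q).
  by move=> H; congr 'X_(enum_rank _); apply: val_inj.
case: eq => [/Xv->|/Xv e]; first exact: mono_topX.
by rewrite cell_mxC e; apply: mono_topN; apply: mono_topX.
Qed.

Lemma wdeg_cell_mx i j : rlt i j -> X i j != 0 /\ wdeg (X i j) = (w i j).+1.
Proof.
move=> lt; have [p [el eh] _] := cell_of_pair lt.
have H := cell_mx_lead el eh; split; first exact: mono_top_neq0 H.
by rewrite (mono_top_wdeg H) wt_cell /cell_weight el eh.
Qed.

Lemma contr_wdeg (x : 'I_n -> cell_ring k n) g s b :
  (forall s1 j s2, s = s1 ++ j :: s2 -> (wdeg (x j * g (s1 ++ s2)) <= b)%N) ->
  (wdeg (contr x g s) <= b)%N.
Proof.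
elim: s g => [|j s IHs] g H; first by apply/wdeg_leP => m; rewrite msupp0.
rewrite [contr _ _ _]/=; apply: leq_trans (wdegD _ _ _) _; rewrite geq_max wdegN.
rewrite (H [::] j s erefl) /=; apply: IHs => s1 i s2 es.
by apply: (H (j :: s1) i s2); rewrite es.
Qed.

Lemma weight_exchange (i h x l : 'I_n) : rlt i h -> rlt i x -> rlt h l -> rlt x l ->
  (w i x + w h l < w i l + w h x)%N.
Proof.
rewrite /rlt /w; have := ltn_ord (rho l); move: (rho l : nat) (rho i : nat) (rho h : nat) (rho x : nat).
move=> L I H Y *.
have : (I * Y <= n * n)%N by nia.
have : (H * L <= n * n)%N by nia.
have : (I * L <= n * n)%N by nia.
have : (H * Y <= n * n)%N by nia.
have : (I * L + H * Y < I * Y + H * L)%N by nia.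
lia.
Qed.

(** By induction on the list, the first index must be matched with the last one.
If it were matched with x instead, the induction hypothesis for the remaining
list matches its head h with the last index l; exchanging the pairs (i, x) and
(h, l) for (i, l) and (h, x) increases the weight, and the second clause bounds
the terms that contain the pair (h, x). *)
Lemma pf_lead s : pairwise rlt s -> ~~ odd (size s) ->
  [/\ exists m, mono_top (lpf s) m,
      forall i s1 x s2, s = i :: s1 ++ x :: s2 -> (w i x + W (s1 ++ s2) <= W s)%N &
      forall i s' l, s = i :: rcons s' l -> W s = (w i l + W s')%N /\
        forall p m, lo p = rho i -> hi p = rho l -> mono_top (lpf s') m ->
          mono_top (lpf s) (U_(enum_rank p) + m)%MM].
Proof.
have [b] := ubnP (size s); elim: b s => // b IHb [|i s0] ltb.
  by move=> _ _; split=> //; exists 0%MM; apply: mono_top1.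
case/lastP: s0 ltb => [|s' l] //.
rewrite /= size_rcons => ltb; rewrite all_rcons pairwise_rcons.
case/andP=> /andP [il is'] /andP [s'l pws']; rewrite /= !negbK => ev.
have sub s1 x s2 : s' = s1 ++ x :: s2 ->
    [/\ rlt i x, rlt x l, pairwise rlt (s1 ++ s2) & odd (size (s1 ++ s2))].
  move=> e; move: is' s'l pws' ev; rewrite e !all_cat /= !pairwise_cat /= !size_cat /=.
  case/and3P=> _ -> _ /and3P [_ -> _] /and3P [].
  rewrite allrel_consr => /andP [_ ->] -> /andP [_ ->]; split=> //.
  by move: ev; rewrite addnS /= negbK.
have [[m' lm'] ub' _] := IHb s' (ltnW ltb) pws' ev.
have rest s1 x s2 : s' = s1 ++ x :: s2 ->
    lpf (rcons (s1 ++ s2) l) != 0 /\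
    (w i x + W (rcons (s1 ++ s2) l) < w i l + W s')%N.
  move=> e; have [ix xl pw od] := sub _ _ _ e.
  case Et: (s1 ++ s2) pw od => [//|h t] pw od.
  have memt j : j \in h :: t -> j \in s'.
    by rewrite -Et e !mem_cat inE => /orP [->|->]; rewrite ?orbT.
  have ih : rlt i h by apply: (allP is'); apply: memt; rewrite mem_head.
  have hl : rlt h l by apply: (allP s'l); apply: memt; rewrite mem_head.
  have szt : size s' = (size t).+2.
    by move: (congr1 size e) (congr1 size Et); rewrite !size_cat /=; clear; lia.
  have pwl : pairwise rlt (rcons (h :: t) l).
    by rewrite pairwise_rcons pw andbT; apply/allP => j /memt; apply: (allP s'l).
  have evl : ~~ odd (size (rcons (h :: t) l)) by rewrite size_rcons /= negbK.
  have ltl : (size (rcons (h :: t) l) < b)%N by rewrite size_rcons /=; move: szt ltb; clear; lia.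
  have [[m lm] _ /(_ h t l erefl) [eW _]] := IHb _ ltl pwl evl.
  split; first exact: mono_top_neq0 lm.
  rewrite eW; suff le : (w h x + W t <= W s')%N.
    by move: le (weight_exchange ih ix hl xl); clear; lia.
  case: s1 e Et => [|h' s1] e Et.
    rewrite /w mulnC -/(w x h); apply: (ub' x [::] h t); rewrite e; congr cons; exact: Et.
  by case: Et e => -> <- e; apply: (ub' h s1 x s2).
have lil : rlt i l by exact: il.
have [Xil0 wXil] := wdeg_cell_mx lil.
have s'0 : lpf s' != 0 by exact: mono_top_neq0 lm'.
have W'0 : (0 < W s')%N by rewrite wdeg_gt0.
have wprod x g : rlt i x -> g != 0 -> wdeg (X i x * g) = (w i x + wdeg g)%N.
  by move=> ix g0; have [X0 eX] := wdeg_cell_mx ix; rewrite wdegM // eX.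
have eF : lpf (i :: rcons s' l) = (-1) ^+ odd (size s') * (X i l * lpf s') +
    contr (X i) (fun t => lpf (rcons t l)) s'.
  by rewrite /cell_pf pf_cons contr_rcons signr_odd.
have restW : (wdeg (contr (X i) (fun t => lpf (rcons t l)) s') < w i l + W s')%N.
  rewrite -(ltn_predK (leq_trans W'0 (leq_addl (w i l) _))) ltnS.
  apply: contr_wdeg => s1 x s2 e; have [ix _ _ _] := sub _ _ _ e.
  have [g0 lt] := rest _ _ _ e; rewrite wprod //; move: lt; clear; lia.
(* the pair (i, l) contributes the last term of the expansion *)
have lead p m : lo p = rho i -> hi p = rho l -> mono_top (lpf s') m ->
    mono_top (lpf (i :: rcons s' l)) (U_(enum_rank p) + m)%MM.
  move=> el eh lm; have lprod := mono_topM (cell_mx_lead el eh) lm.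
  have lsgn := mono_top_sign (odd (size s')) lprod.
  rewrite eF; apply: (mono_topD lsgn); rewrite (mono_top_wdeg lsgn) -(mono_top_wdeg lprod).
  by rewrite wprod.
have [p0 [el0 eh0] _] := cell_of_pair lil.
have lm0 := lead _ _ el0 eh0 lm'.
have eW : W (i :: rcons s' l) = (w i l + W s')%N.
  by rewrite (mono_top_wdeg lm0) wtD wt_cell /cell_weight el0 eh0 (mono_top_wdeg lm') addnS.
split; first by exists (U_(enum_rank p0) + m')%MM.
  move=> i' s1 x s2 [<-] e; rewrite eW.
  case/lastP: s2 e => [|s2 l'] e.
    move: e; rewrite cats1 cats0 => /rcons_inj [-> ->]; exact: leqnn.
  move: e; rewrite -rcons_cons -rcons_cat => /rcons_inj [e <-].
  by rewrite -rcons_cat; have [_ /ltnW] := rest _ _ _ e.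
by move=> i' s'' l' [<-] /rcons_inj [<- <-]; split.
Qed.

(** Cells of an antichain are nested in one another, so they are the nested
matching of the list of their ends. *)
Lemma antichain_pf C : antichain rho C -> exists s,
  [/\ pairwise rlt s, ~~ odd (size s), mono_top (lpf s) (mcells C) &
      forall i, i \in s = [exists p in C, (rho i == lo p :> nat) || (rho i == hi p :> nat)]].
Proof.
have [b] := ubnP #|C|; elim: b C => // b IHb C ltb aC.
have [->|/set0Pn [p0 p0C]] := eqVneq C set0.
  exists [::]; split=> //.
    have -> : mcells (set0 : {set cell}) = 0%MM.
      by apply/mnmP => i; rewrite mnmE inE mnm0E.
    exact: mono_top1.
  by move=> i; rewrite in_nil; apply/esym/existsP => -[p]; rewrite inE.
case: (@arg_minnP _ p0 (mem C) lo p0C) => p pC' minp; have {pC'}pC : p \in C := pC'.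
have aC' : antichain rho (C :\ p).
  by move=> q r; rewrite !inE => /andP [_ qC] /andP [_ rC]; apply: aC.
have [|s [pws evs ms ins]] := IHb (C :\ p) _ aC'.
  by move: ltb; rewrite (cardsD1 p) pC.
have nest q : q \in C :\ p -> (lo p < lo q)%N /\ (hi q < hi p)%N.
  rewrite !inE => /andP [qp qC]; have := minp _ qC.
  have npq : ~~ cell_le rho p q by apply: contra qp => /(aC p q pC qC) ->.
  have nqp : ~~ cell_le rho q p by apply: contra qp => /(aC q p qC pC) ->.
  by move: npq nqp; rewrite /cell_le; clear; lia.
have lh := lo_lt_hi rho p; have hn := hi_lt rho p; have ln := ltn_trans lh hn.
pose i := (rho^-1)%g (Ordinal ln); pose l := (rho^-1)%g (Ordinal hn).
have ei : rho i = lo p :> nat by rewrite permKV.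
have el : rho l = hi p :> nat by rewrite permKV.
have lsl j : j \in s -> rlt i j /\ rlt j l.
  rewrite ins /rlt ei el => /existsP [q /andP [/nest [n1 n2] H]].
  have := lo_lt_hi rho q; move: n1 n2; case/orP: H => /eqP ->; clear; lia.
have pw : pairwise rlt (i :: rcons s l).
  rewrite /= all_rcons pairwise_rcons pws andbT /rlt ei el lh /=.
  by apply/andP; split; apply/allP => j /lsl; rewrite /rlt ei el => -[].
have ev : ~~ odd (size (i :: rcons s l)) by rewrite /= size_rcons /= negbK.
exists (i :: rcons s l); split=> //.
  have [_ _ /(_ i s l erefl) [_ /(_ p _ (esym ei) (esym el) ms)]] := pf_lead pw ev.
  congr mono_top; apply/mnmP => j; rewrite mnmDE mnm1E !mnmE !inE -[j in _ == j]enum_valK.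
  by rewrite (inj_eq enum_rank_inj) eq_sym; case: eqP => // ->; rewrite pC.
move=> j; rewrite inE mem_rcons inE ins.
have eqr (y z : 'I_n) : (y == z) = (rho y == rho z :> nat).
  by rewrite val_eqE (inj_eq perm_inj).
rewrite !eqr ei el orbA; apply/orP/existsP => [[H|]|[q /andP [qC H]]].
- by exists p; rewrite pC.
- by case/existsP=> q /andP []; rewrite inE => /andP [_ qC] H; exists q; rewrite qC.
- have [eqp|qp] := eqVneq q p; first by left; rewrite -eqp.
  by right; apply/existsP; exists q; rewrite !inE qp qC.
Qed.

(** The minimal cells are stripped off, one Pfaffian for each unit of width. *)
Lemma filt_lift d m : width_le rho m d -> exists2 h, filt d h & mono_top h m.
Proof.
elim: d m => [|d IHd] m wdm.
  exists 1; first by rewrite -mpolyC1; apply: filtC.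
  suff -> : m = 0%MM by apply: mono_top1.
  by apply/eqP; apply: contraT => m0; have [] := width_minimal m0 wdm.
have [->|m0] := eqVneq m 0%MM.
  exists 1; last exact: mono_top1.
  by apply: (filt_le x0 (leq0n _)); rewrite -mpolyC1; apply: filtC.
have [_ wdm'] := width_minimal m0 wdm; have [h Fh lh] := IHd _ wdm'.
have [s [pws evs ms _]] := antichain_pf (antichain_minimal (rho := rho) (m := m)).
have us : uniq s by apply: pairwise_uniq pws => i; rewrite /rlt ltnn.
exists (lpf s * h); first by rewrite -add1n; apply: filtM Fh; apply: filt_lpf.
have := mono_topM ms lh; rewrite addmC submK // mcells_le.
by apply/subsetP => p; rewrite !inE => /andP [].
Qed.

Lemma spinor_line c (I : {set 'I_n}) :
  (forall i, (rev_ord i \in I) =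
     ~~ [&& rho i <= c, c - rho i < n & (rho i).*2 != c]%N) ->
  filt 1 (spinor_cell k I) /\ mono_top (spinor_cell k I) (mcells (line rho c)).
Proof.
move=> memI; have [s [pws evs ms ins]] := antichain_pf (antichain_line (rho := rho) (c := c)).
have us : uniq s by apply: pairwise_uniq pws => i; rewrite /rlt ltnn.
rewrite (spinor_cell_lpf k x0).
have ps : perm_eq (enum (~: [set rev_ord i | i in I])) s.
  apply: uniq_perm => //; first exact: enum_uniq.
  move=> i; rewrite mem_enum in_setC -{1}[i]rev_ordK mem_imset; last exact: rev_ord_inj.
  rewrite memI negbK ins; apply/and3P/existsP => [[h1 h2 h3]|[p]].
    have [lt|lt|e] := ltngtP (rho i) (c - rho i)%N; last by lia.
      have [|p el eh] := @cell_exists _ rho (rho i) (c - rho i); first by rewrite lt.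
      by exists p; rewrite inE el eh eqxx subnKC // eqxx.
    have [|p el eh] := @cell_exists _ rho (c - rho i) (rho i); first by rewrite lt ltn_ord.
    by exists p; rewrite inE el eh eqxx subnK // eqxx orbT.
  rewrite inE => /andP [/eqP ec /orP e]; have := lo_lt_hi rho p; have := hi_lt rho p.
  by case: e => /eqP ->; move: ec; clear; split; lia.
have [b eb] := alternating_perm (alternating_pf (@cell_mxC k n)) ps.
rewrite /cell_pf eb; split; last exact: mono_top_sign ms.
have Fs := filt_lpf k x0 us evs.
by case: b {eb}; rewrite ?expr1 ?expr0 ?mul1r // mulN1r; apply: filtN.
Qed.

End PfaffianLead.

(** * From the open cell to the Grassmannian *)

Lemma ideal_gen_nil (R : comNzRingType) (x : R) : ideal_gen [::] x <-> x = 0.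
Proof.
by split=> [[c ->]|->]; [|exists (fun=> 0)]; rewrite big_ord0.
Qed.

Lemma ideal_gen_cons (R : comNzRingType) (a : R) s x :
  ideal_gen (a :: s) x <-> exists c y, ideal_gen s y /\ x = c * a + y.
Proof.
split=> [[c ->]|[c [y [[d ->] ->]]]].
  rewrite big_ord_recl; exists (c ord0), (\sum_(i < size s) c (lift ord0 i) * s`_i).
  by split=> //; exists (fun i => c (lift ord0 i)).
exists (fun i => if unlift ord0 i is Some j then d j else c).
rewrite big_ord_recl unlift_none; congr (_ + _).
by apply: eq_bigr => i _; rewrite liftK.
Qed.

Lemma ideal_genD (R : comNzRingType) s (x y : R) :
  ideal_gen s x -> ideal_gen s y -> ideal_gen s (x + y).
Proof.
move=> [c ->] [d ->]; exists (fun i => c i + d i).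
by rewrite -big_split; apply: eq_bigr => i _; rewrite mulrDl.
Qed.

Lemma comb_ideal_gen (k : fieldType) N (T : eqType) (p : T -> {mpoly k[N]}) cs f :
  comb p (fun=> True) cs f <-> ideal_gen (map p cs) f.
Proof.
elim: cs f => [|c cs IHcs] f; first by rewrite ideal_gen_nil.
rewrite ideal_gen_cons; split=> [[a [g [_ /IHcs Ig ->]]]|[a [g [/IHcs Ig ->]]]].
  by exists a, g.
by exists a, g.
Qed.

Section Lines.
Variables (k : closedFieldType) (n : nat) (rho : {perm 'I_n}) (x0 : 'I_n).
Local Notation A := (cell_ring k n).
Local Notation filt := (@OGr_filt k n).
Local Notation om := (cell_om rho).
Implicit Types (c : nat) (cs : seq nat) (f g : A) (F : {poly A}).

(** The subset I for which q_I restricts to the Pfaffian on the ends of the cells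
of the line c. *)
Definition line_set c : {set 'I_n} := [set i | ~~ [&& rho (rev_ord i) <= c,
  c - rho (rev_ord i) < n & (rho (rev_ord i)).*2 != c]%N].

Definition line_pf c : A := spinor_cell k (line_set c).

(** The values of c for which a monotone path from the lowest to the highest cell
has to cross the line. *)
Definition line_index c := (0 < c)%N && (c + 2 < n.*2)%N.

Local Notation mm := (fun c => mcells (line rho c)).
Local Notation ideal cs := (comb line_pf (fun=> True) cs).

Lemma line_set_memP c i : (rev_ord i \in line_set c) =
  ~~ [&& rho i <= c, c - rho i < n & (rho i).*2 != c]%N.
Proof. by rewrite inE rev_ordK. Qed.

Lemma filt_line c : filt 1 (line_pf c).
Proof. by have [] := spinor_line k x0 (line_set_memP c). Qed.

Lemma mono_top_line c : mono_top om (line_pf c) (mcells (line rho c)).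
Proof. by have [] := spinor_line k x0 (line_set_memP c). Qed.

Lemma mcells_line_neq0 c : line_index c -> mcells (line rho c) != 0%MM.
Proof.
case/andP=> c0 cn; have ch0 : chain rho set0 by apply/chainP => p q; rewrite inE.
have [e el _] := line_hit c0 cn ch0; apply/eqP => /mnmP /(_ (enum_rank e)).
by rewrite mcellsE el mnm0E.
Qed.

Lemma cell_filtration : lead_filtration om filt (width_le rho).
Proof.
split; [exact: filtC | exact: filtD | exact: filtM | exact: filtS | exact: filt_all | |].
- exact: filt_width.
- exact: filt_lift.
Qed.

Lemma line_family : lead_family om filt (width_le rho) line_index line_pf mm.
Proof.
split.
- by move=> c _; apply: filt_line.
- by move=> c _; apply: mono_top_line.
- exact: mcells_line_neq0.
- by move=> c i _; rewrite mnmE leq_b1.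
- by move=> c c' i _ _ ne; rewrite !mnmE !inE; case: eqP => // -> _; rewrite (negPf ne).
- by move=> c m d /andP [c0 cn] le; apply: width_sub le _ => K cK _; apply: line_hit.
Qed.

Section Family.
Variable cs : seq nat.
Hypotheses (ucs : uniq cs) (Vcs : all line_index cs).

Lemma line_index_take i : (i < size cs)%N ->
  uniq (nth 0%N cs i :: take i cs) /\ all line_index (nth 0%N cs i :: take i cs).
Proof.
move=> lti; have e := cat_take_drop i cs; rewrite (drop_nth 0%N lti) in e.
have u := ucs; have V := Vcs; rewrite -e cat_uniq in u; rewrite -e all_cat in V.
move: u V => /= /and3P [-> ]; rewrite negb_or => /andP [-> _] _ /andP [-> /andP [-> _]].
by [].
Qed.

Lemma regular_line_cell : regular_seq (map line_pf cs).
Proof.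
split=> [[i lti] x|] /=; last first.
  by move/comb_ideal_gen; apply: ideal_proper cell_filtration line_family _ ucs Vcs.
rewrite size_map in lti; have [ui Vi] := line_index_take lti.
rewrite -map_take (nth_map 0%N) //.
move/comb_ideal_gen => H; apply/comb_ideal_gen.
exact: (ideal_regular cell_filtration line_family ui Vi H).
Qed.

Lemma radical_line_cell : radical_ideal (ideal_gen (map line_pf cs)).
Proof.
move=> x m /comb_ideal_gen H; apply/comb_ideal_gen.
exact: (ideal_radical cell_filtration line_family ucs Vcs H).
Qed.

End Family.

Lemma OGr_valD (x y : OGr_ring k n) : OGr_val (x + y) = OGr_val x + OGr_val y.
Proof. exact: (rmorphD (val : OGr_ring k n -> _)). Qed.

Lemma OGr_valM (x y : OGr_ring k n) : OGr_val (x * y) = OGr_val x * OGr_val y.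
Proof. exact: (rmorphM (val : OGr_ring k n -> _)). Qed.

Lemma OGr_val0 : OGr_val (0 : OGr_ring k n) = 0.
Proof. exact: (rmorph0 (val : OGr_ring k n -> _)). Qed.

Lemma OGr_val1 : OGr_val (1 : OGr_ring k n) = 1.
Proof. exact: (rmorph1 (val : OGr_ring k n -> _)). Qed.

Lemma OGr_valX (x : OGr_ring k n) e : OGr_val (x ^+ e) = OGr_val x ^+ e.
Proof. exact: (rmorphXn (val : OGr_ring k n -> _)). Qed.

Lemma coef_OGr_ideal cs (x : OGr_ring k n) :
  ideal_gen (map (fun c => spinor k (line_set c)) cs) x -> forall d, ideal cs (OGr_val x)`_d.
Proof.
elim: cs x => [|c cs IHcs] x.
  by move=> /ideal_gen_nil -> d; rewrite OGr_val0 coef0.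
move/ideal_gen_cons => [a [y [/IHcs Iy ->]]] d.
exists ((OGr_val a * 'X)`_d), (OGr_val y)`_d; split=> //.
rewrite OGr_valD coefD OGr_valM; congr (_ + _).
by rewrite /= mulrA coefMC.
Qed.

(** Coefficients one step down in the filtration are what is needed to write a
homogeneous element with coefficients in the homogeneous coordinate ring. *)
Lemma homogeneous_OGr_ideal cs e g : comb line_pf (filt e) cs g ->
  exists2 x : OGr_ring k n, OGr_val x = g%:P * 'X^(e.+1) &
    ideal_gen (map (fun c => spinor k (line_set c)) cs) x.
Proof.
elim: cs g => [|c cs IHcs] g.
  by move=> ->; exists 0; [rewrite OGr_val0 polyC0 mul0r | apply/ideal_gen_nil].
move=> [a [g' [Fa /IHcs [y ey Iy] ->]]].
have Pa : a%:P * 'X^e \in @OGr_pred k n by apply/asboolP; rewrite -filtE.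
exists (MkOGr Pa * spinor k (line_set c) + y); last first.
  by apply/ideal_gen_cons; exists (MkOGr Pa), y.
rewrite OGr_valD OGr_valM ey polyCD polyCM mulrDl; congr (_ + _) => /=.
by rewrite exprSr mulrA mulrAC -!mulrA ['X * _]mulrC !mulrA [_ * 'X^e]mulrAC.
Qed.

Lemma OGr_ideal_of_coef cs (x : OGr_ring k n) : uniq cs -> all line_index cs ->
  (forall d, ideal cs (OGr_val x)`_d) ->
  ideal_gen (map (fun c => spinor k (line_set c)) cs) x.
Proof.
move=> ucs Vcs Ix; set qs := map _ _.
have Fx d : filt d (OGr_val x)`_d by apply: filt_coef; apply/asboolP; case: (x).
suff [y ey Iy] : exists2 y : OGr_ring k n,
    OGr_val y = \sum_(i < size (OGr_val x)) (OGr_val x)`_i *: 'X^i & ideal_gen qs y.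
  by rewrite -poly_def coefK in ey; have -> : x = y by apply: val_inj.
elim: (size _) => [|m [y ey Iy]].
  by exists 0; [rewrite big_ord0 OGr_val0 | exists (fun=> 0); rewrite big1 // => i _; rewrite mul0r].
have [z ez Iz] : exists2 z : OGr_ring k n, OGr_val z = (OGr_val x)`_m *: 'X^m & ideal_gen qs z.
  have [->|nz] := eqVneq (OGr_val x)`_m 0.
    by exists 0; [rewrite scale0r OGr_val0 | exists (fun=> 0); rewrite big1 // => i _; rewrite mul0r].
  have [m0 /homogeneous_OGr_ideal [z ez Iz]] :=
    comb_filtered cell_filtration line_family ucs Vcs (Fx m) (Ix m) nz.
  by exists z => //; rewrite ez prednK // mul_polyC.
exists (y + z); last exact: ideal_genD.
by rewrite OGr_valD ey ez big_ord_recr.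
Qed.

(** Polynomials over a reduced ring form a reduced ring; the leading coefficient
of a power is the power of the leading coefficient. *)
Lemma coef_radical cs F e : uniq cs -> all line_index cs ->
  (forall d, ideal cs (F ^+ e)`_d) -> forall d, ideal cs F`_d.
Proof.
move=> ucs Vcs; have [b leb] : exists b, (size F <= b)%N by exists (size F).
have Irad := @radical_line_cell _ ucs Vcs.
elim: b F leb => [|b IHb] F leb IF.
  move=> d; rewrite nth_default; first exact: comb0.
  by apply: leq_trans leb _.
have IFb : ideal cs F`_b.
  have [lt|ge] := ltnP (size F) b.+1.
    rewrite nth_default //; exact: comb0.
  have eb : size F = b.+1 by apply/eqP; rewrite eqn_leq leb ge.
  apply/comb_ideal_gen/(Irad _ e)/comb_ideal_gen.
  have -> : F`_b = lead_coef F by rewrite lead_coefE eb.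
  by rewrite -lead_coef_exp lead_coefE.
pose G := F - (F`_b)%:P * 'X^b.
have sG : (size G <= b)%N.
  apply/leq_sizeP => j; rewrite leq_eqVlt coefB coefCM coefXn => /predU1P [<-|lt].
    by rewrite eqxx mulr1 subrr.
  by rewrite (gtn_eqF lt) mulr0 subr0 nth_default //; apply: leq_trans leb lt.
move=> d; have -> : F`_d = G`_d + ((F`_b)%:P * 'X^b)`_d by rewrite -coefD subrK.
have IC H d' : ideal cs ((F`_b)%:P * H)`_d'.
  by rewrite coefCM mulrC; apply: combM IFb.
apply: combD => //; apply: IHb => // d'.
have -> : G ^+ e = F ^+ e - (F ^+ e - G ^+ e) by rewrite opprB addrC subrK.
rewrite coefB; apply: idealB => //; rewrite subrXX.
by rewrite /G opprB addrC subrK -mulrA.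
Qed.

Lemma regular_line_OGr cs : uniq cs -> all line_index cs ->
  regular_seq (map (fun c => spinor k (line_set c)) cs).
Proof.
move=> ucs Vcs; split=> [[i lti] x|] /=; last first.
  move/coef_OGr_ideal/(_ 0%N); rewrite OGr_val1 coef1 /=.
  exact: ideal_proper cell_filtration line_family _ ucs Vcs.
have lti' : (i < size cs)%N by move: lti; rewrite size_map.
have [ui Vi] := line_index_take ucs Vcs lti'.
have [[_ ut] [_ Vt]] := (andP ui, andP Vi).
rewrite -map_take (nth_map 0%N) // => /coef_OGr_ideal H.
apply: OGr_ideal_of_coef => // d; have := H d.+1.
rewrite OGr_valM /= -mulrA coefXM /= coefCM.
exact: (ideal_regular cell_filtration line_family ui Vi).
Qed.

Lemma radical_line_OGr cs : uniq cs -> all line_index cs ->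
  radical_ideal (ideal_gen (map (fun c => spinor k (line_set c)) cs)).
Proof.
move=> ucs Vcs x m /coef_OGr_ideal H; apply: OGr_ideal_of_coef => //.
by apply: (coef_radical ucs Vcs (e := m)) => d; rewrite -OGr_valX.
Qed.

End Lines.

(** For n odd the Pfaffians omit the indices 1, 2, 3 respectively, which are given
the smallest, the middle and the largest rank.  For n even they omit nothing,
{1, 2} and {1, 3}; the indices 1 and 2 keep the two smallest ranks and 3 is given
a middle one.  In each case there remain the ends of the cells of a line. *)
Lemma first_spinor_line_sets n : (4 <= n)%N -> exists (rho : {perm 'I_n}) cs,
  [/\ uniq cs, all (line_index n) cs & first_spinor_sets n = map (line_set rho) cs].
Proof.
move=> hn; have lt1 : (1 < n)%N by lia.
have lt2 : (2 < n)%N by lia.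
have lth : (n./2 < n)%N by lia.
have ltm : (n.-1 < n)%N by lia.
pose i1 := Ordinal lt1; pose i2 := Ordinal lt2.
pose ih := Ordinal lth; pose im := Ordinal ltm.
pose i0 := Ordinal (ltn_trans (ltn0Sn 0) lt1).
have half := odd_double_half n.
have setE (rho : {perm 'I_n}) c s (P : pred nat) :
    (forall r, (r < n)%N -> ~~ [&& r <= c, c - r < n & r.*2 != c]%N = P r) ->
    (forall j : 'I_n, P (rho j) = (n - j \in s)%N) -> subset_of_seq n s = line_set rho c.
  move=> H1 H2; apply/setP => i; rewrite !inE H1 ?ltn_ord // H2 /=.
  by congr (_ \in s); have := ltn_ord i; lia.
have rhoP (rho : {perm 'I_n}) a b : rho a = b -> forall j, (rho j == b :> nat) = (j == a :> nat).
  by move=> <- j; rewrite !val_eqE (inj_eq perm_inj).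
rewrite /first_spinor_sets; case: ifP half => on half.
  pose rho := (tperm i2 im * tperm i1 ih)%g.
  have n21 : i1 != i2 by [].
  have nm1 : i1 != im by rewrite -val_eqE /=; lia.
  have n02 : i0 != i2 by [].
  have n01 : i0 != i1 by [].
  have n0m : i0 != im by rewrite -val_eqE /=; lia.
  have n0h : i0 != ih by rewrite -val_eqE /=; lia.
  have nhm : ih != im by rewrite -val_eqE /=; lia.
  have r0 : rho i0 = i0 by rewrite permM !tpermD // eq_sym.
  have r1 : rho i1 = ih by rewrite permM [tperm i2 im _]tpermD ?tpermL // eq_sym.
  have r2 : rho i2 = im by rewrite permM tpermL tpermD.
  exists rho, [:: n; n.-1; n.-2]; split.
  - by rewrite /= !inE; lia.
  - by rewrite /= /line_index; lia.
  congr [:: _; _; _].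
  - apply: (setE rho _ _ (fun r => r == 0)%N) => [r rn|j]; first by lia.
    by rewrite (rhoP _ _ _ r0) inE /=; have := ltn_ord j; lia.
  - apply: (setE rho _ _ (fun r => r == n./2)%N) => [r rn|j]; first by lia.
    by rewrite (rhoP _ _ _ r1) inE /=; have := ltn_ord j; lia.
  - apply: (setE rho _ _ (fun r => r == n.-1)%N) => [r rn|j]; first by lia.
    by rewrite (rhoP _ _ _ r2) inE /=; have := ltn_ord j; lia.
pose rho := tperm i2 ih.
have n02 : i2 != i0 by [].
have n0h : ih != i0 by rewrite -val_eqE /=; lia.
have n12 : i2 != i1 by [].
have n1h : ih != i1 by rewrite -val_eqE /=; lia.
have r0 : rho i0 = i0 by rewrite tpermD.
have r1 : rho i1 = i1 by rewrite tpermD.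
have r2 : rho i2 = ih by rewrite tpermL.
exists rho, [:: n.-1; n.+1; n]; split.
- by rewrite /= !inE; lia.
- by rewrite /= /line_index; lia.
congr [:: _; _; _].
- apply: (setE rho _ _ (fun _ => false)) => [r rn|j]; first by lia.
  by rewrite in_nil.
- apply: (setE rho _ _ (fun r => (r == 0) || (r == 1))%N) => [r rn|j]; first by lia.
  by rewrite (rhoP _ _ _ r0) (rhoP _ _ _ r1) !inE /=; have := ltn_ord j; lia.
- apply: (setE rho _ _ (fun r => (r == 0) || (r == n./2))%N) => [r rn|j]; first by lia.
  by rewrite (rhoP _ _ _ r0) (rhoP _ _ _ r2) !inE /=; have := ltn_ord j; lia.
Qed.

Theorem proposition4p5 (k : closedFieldType) (n : nat) (hn : (4 <= n)%N) :
  [/\ regular_seq (first_spinors k n),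
      regular_seq (map (@restrict_cell k n) (first_spinors k n)),
      radical_ideal (ideal_gen (first_spinors k n)) &
      radical_ideal (ideal_gen (map (@restrict_cell k n) (first_spinors k n)))].
Proof.
have [rho [cs [ucs Vcs ecs]]] := first_spinor_line_sets hn.
have x0 : 'I_n by apply: (@Ordinal n 0); apply: leq_trans hn.
have eq : first_spinors k n = map (fun c => spinor k (line_set rho c)) cs.
  by rewrite /first_spinors ecs -map_comp.
have er : map (@restrict_cell k n) (first_spinors k n) = map (line_pf k rho) cs.
  by rewrite eq -map_comp; apply: eq_map => c /=; apply: restrict_spinor.
rewrite er eq; split.
- exact: regular_line_OGr.
- exact: regular_line_cell.
- exact: radical_line_OGr.
- exact: radical_line_cell.
Qed.
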